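(* Let $k\geq 2$ be an integer, let $\Omega_1,\Omega_2\subset\mathbb{C}$ be domains, and let $T$ map $\Omega_2$ conformally onto $\Omega_1$. Let $h=(T')^{(1-k)/2}$. Suppose that $\{f_1,\dotsc,f_k\}$ is a solution base of the differential equation \[ f^{(k)} + a_{k-2} f^{(k-2)} +a_{k-3} f^{(k-3)} + \dotsb + a_1 f' +a_0 f = 0, \] where the coefficients $a_0, \dotsc, a_{k-2}$ are analytic in $\Omega_1$. Then $\{(f_1 \circ T) h,\dotsc,(f_k \circ T) h \}$ is a solution base of a differential equation \[ g^{(k)} + b_{k-2} g^{(k-2)} +b_{k-3} g^{(k-3)} + \dotsb + b_1 g' +b_0 g = 0, \] whose coefficients $b_0,\dotsc, b_{k-2}$ are analytic in $\Omega_2$. Moreover, for any $\ell\in \{ 1, \dotsc, k-2\}$, \[ \begin{split} (a_\ell \circ T)(T')^{k-\ell} & = \sum_{j=\ell}^{k-1} b_j \left[ \sum_{i=\ell}^j \binom{j}{i} \, \frac{B_{i,\ell}\big( T', \dotsc, T^{(i-\ell+1)} \big)}{(T')^\ell} \, \frac{h^{(j-i)}}{h} \right]\\ & \qquad + \sum_{i=\ell}^{k-1} \binom{k}{i} \frac{B_{i,\ell}\big( T', \dotsc, T^{(i-\ell+1)} \big)}{(T')^\ell} \, \frac{h^{(k-i)}}{h} + \frac{B_{k,\ell}\big( T', \dotsc, T^{(k-\ell+1)} \big)}{(T')^\ell}, \end{split} \] (with the convention $b_{k-1}\equiv 0$), and \[ (a_0 \circ T) \, (T')^k = \frac{h^{(k)}}{h}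 + b_{k-2} \, \frac{h^{(k-2)}}{h} + \dotsb + b_1 \frac{h'}{h} + b_0 . \]
   Context: For integers $i\geq n\geq 1$, the incomplete exponential Bell polynomial is \[ B_{i,n}\big( z_1,\dotsc,z_{i-n+1} \big) = \sum \frac{i!}{j_1! \, j_2! \dotsb j_{i-n+1}!} \left( \frac{z_1}{1!} \right)^{j_1} \left( \frac{z_2}{2!} \right)^{j_2} \dotsb \left( \frac{z_{i-n+1}}{(i-n+1)!}\right)^{j_{i-n+1}}, \] where the sum is over all sequences $j_1,\dots,j_{i-n+1}$ of non-negative integers with $i = j_1 + 2 j_2 + \dotsb + (i-n+1) j_{i-n+1}$ and $n = j_1 + j_2 + \dotsb + j_{i-n+1}$. Here $h=(T')^{(1-k)/2}$ denotes an analytic branch of this power of the non-vanishing function $T'$. *)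

(* Defs.v *)
From HB Require Import structures.
From mathcomp Require Import all_boot all_order all_algebra.
From mathcomp Require Import complex.
From mathcomp Require Import all_classical all_reals all_analysis.
Unset Printing Implicit Defensive.
Import Order.TTheory GRing.Theory Num.Theory.
Import numFieldNormedType.Exports.
Local Open Scope ring_scope.
Local Open Scope classical_set_scope.

(* The complex plane, with the normed (metric) structure given by the modulus.
   Derivatives of functions CC R -> CC R are complex derivatives. *)
Definition CC (R : realType) := (R[i])^o.

Definition cder {R : realType} (n : nat) (f : CC R -> CC R) : CC R -> CC R :=
  derive1n n f.

Definition domain {R : realType} (D : set (CC R)) : Prop :=
  D !=set0 /\ open D /\ connected D.

Definition analytic_on {R : realType} (D : set (CC R)) (f : CC R -> CC R) : Prop :=
  forall z, D z -> derivable f z 1.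

Definition conformal_onto {R : realType} (D2 D1 : set (CC R)) (T : CC R -> CC R) : Prop :=
  [/\ analytic_on D2 T,
      (forall z, D2 z -> cder 1 T z != 0),
      (forall z w, D2 z -> D2 w -> T z = T w -> z = w) &
      T @` D2 = D1].

(* h is an analytic branch of (T')^((1-k)/2) on D: h analytic and
   h^2 = (T')^(1-k), i.e. h^2 (T')^(k-1) = 1. *)
Definition branch_pow {R : realType} (D : set (CC R)) (T h : CC R -> CC R) (k : nat) : Prop :=
  analytic_on D h /\ forall z, D z -> h z ^+ 2 * (cder 1 T z) ^+ (k.-1) = 1.

Definition solves {R : realType} (D : set (CC R)) (k : nat)
  (a : nat -> CC R -> CC R) (f : CC R -> CC R) : Prop :=
  forall z, D z -> cder k f z + \sum_(j < k.-1) a j z * cder j f z = 0.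

Definition solution_base {R : realType} (D : set (CC R)) (k : nat)
  (a : nat -> CC R -> CC R) (f : 'I_k -> CC R -> CC R) : Prop :=
  [/\ forall i, analytic_on D (f i),
      forall i, solves D k a (f i) &
      forall c : 'I_k -> CC R,
        (forall z, D z -> \sum_(i < k) c i * f i z = 0) -> forall i, c i = 0].

(* incomplete exponential Bell polynomial B_{i,n}(z_1,...,z_{i-n+1});
   the argument z is 1-indexed: z m stands for z_m.  The sequences
   (j_1,...,j_{i-n+1}) are encoded as finite functions J with J m = j_{m+1};
   each j_m <= i necessarily, so the range 'I_i.+1 loses nothing. *)
Definition bell {F : fieldType} (i n : nat) (z : nat -> F) : F :=
  \sum_(J : {ffun 'I_((i - n).+1) -> 'I_i.+1} |
          (\sum_(m < (i - n).+1) (m.+1 * J m) == i)%N &&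
          (\sum_(m < (i - n).+1) (J m : nat) == n)%N)
     (i`!)%:R / (\prod_(m < (i - n).+1) (J m)`!)%:R *
     \prod_(m < (i - n).+1) (z m.+1 / (m.+1)`!%:R) ^+ (J m).

(* Main.v *)
(** A complex-differentiable function has a complex-differentiable derivative.
    Goursat's bisection makes the boundary integral of a differentiable function
    over a rectangle vanish; applied in the coordinate [w = z + exp u] to
    [f (z + exp u) exp (- u)], which has period [2 pi i] in [u], it gives
    [2 pi f'(z)] as the integral of [f (z + r e^(it)) / (r e^(it))] over [t].
    This bounds [f'] near a point, so [f] is locally Lipschitz, then [f'] is,
    and the Taylor remainder of [f] is uniformly quadratic: the formula for [f']
    may be differentiated under the integral.

    The rest is triangular algebra.  Leibniz's rule and Faa di Bruno's formula give
    [((f o T) h)^(j) = sum_(l <= j) M_(j,l) (f^(l) o T)] with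
    [M_(l,l) = (T')^l h] nowhere zero, and [M_(k,k-1) = 0] by differentiating
    [h^2 (T')^(k-1) = 1].  So the system
    [sum_(l <= j <= k) b_j M_(j,l) = h (T')^k (a_l o T)], with [b_k = 1] and
    [b_(k-1) = 0], is solved from [l = k-2] down to [0], which yields both the new
    equation and the stated identities. *)

Require Import Defs.
From HB Require Import structures.
From mathcomp Require Import all_boot all_order all_algebra.
From mathcomp Require Import complex.
From mathcomp Require Import all_classical all_reals all_analysis.
From mathcomp Require Import ring lra.
Import Order.TTheory GRing.Theory Num.Theory.
Import numFieldNormedType.Exports.
Local Open Scope ring_scope.
Local Open Scope classical_set_scope.

Local Notation Re := (@complex.Re _).
Local Notation Im := (@complex.Im _).

(** * Complex differentiability in the l1 norm *)

Section Norm1.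
Context {R : realType}.
Implicit Types (z w : R[i]).

(** The hypothesis [analytic_on] grants one complex derivative at each point, while the statement
    involves derivatives of [T] and [h] up to order [k]; even the continuity of the first derivative
    has to be earned. Estimates use the l1 norm [norm1], real-valued, submultiplicative and within a
    factor 2 of the modulus. It splits into real and imaginary parts, so real integration and the
    real mean value theorem apply directly; most powers of 2 in the constants are the price.

    The coordinate [w = z + exp u] turns circles into vertical segments and annuli into rectangles,
    the only shape on which the boundary integral is studied.

    The coefficients [b_j] are defined by the linear system itself. Contracted with the values of
    [f_i^(l)] at [T z] it gives the equation for each [(f_i o T) h]; divided by [M_(l,l)] it is the
    stated identity. *)

Definition norm1 z : R := `|Re z| + `|Im z|.

Lemma ReD z w : Re (z + w) = Re z + Re w. Proof. by case: z; case: w. Qed.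
Lemma ImD z w : Im (z + w) = Im z + Im w. Proof. by case: z; case: w. Qed.
Lemma ReN z : Re (- z) = - Re z. Proof. by case: z. Qed.
Lemma ImN z : Im (- z) = - Im z. Proof. by case: z. Qed.
Lemma ReM z w : Re (z * w) = Re z * Re w - Im z * Im w.
Proof. by case: z; case: w. Qed.
Lemma ImM z w : Im (z * w) = Re z * Im w + Im z * Re w.
Proof. by case: z; case: w. Qed.
Definition ReImE := (ReD, ImD, ReN, ImN, ReM, ImM).

Lemma complex_ext z w : Re z = Re w -> Im z = Im w -> z = w.
Proof. by case: z; case: w => a b c d /= -> ->. Qed.

Lemma norm1_ge0 z : 0 <= norm1 z. Proof. by rewrite addr_ge0. Qed.

Lemma norm1_0 : norm1 0 = 0. Proof. by rewrite /norm1 /= normr0 addr0. Qed.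

Lemma norm1N z : norm1 (- z) = norm1 z.
Proof. by rewrite /norm1 !ReImE !normrN. Qed.

Lemma norm1D z w : norm1 (z + w) <= norm1 z + norm1 w.
Proof. by rewrite /norm1 !ReImE addrACA lerD // ler_normD. Qed.

Lemma norm1B z w : norm1 (z - w) <= norm1 z + norm1 w.
Proof. by rewrite (le_trans (norm1D _ _)) // norm1N. Qed.

Lemma norm1M z w : norm1 (z * w) <= norm1 z * norm1 w.
Proof.
rewrite /norm1 !ReImE mulrDl !mulrDr -!normrM.
have := ler_normB (Re z * Re w) (Im z * Im w).
have := ler_normD (Re z * Im w) (Im z * Re w).
lra.
Qed.

Lemma norm1_eq0 z : norm1 z = 0 -> z = 0.
Proof.
move=> /eqP; rewrite paddr_eq0 // !normr_eq0 => /andP[/eqP a /eqP b].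
exact: complex_ext.
Qed.

Lemma Re_le_norm1 z : `|Re z| <= norm1 z. Proof. by rewrite lerDl. Qed.
Lemma Im_le_norm1 z : `|Im z| <= norm1 z. Proof. by rewrite lerDr. Qed.

Lemma norm_le_norm1 z : `|z| <= (norm1 z)%:C%C.
Proof.
rewrite normc_def lecR -[leRHS](@ger0_norm _ (norm1 z)) ?norm1_ge0 // -sqrtr_sqr.
rewrite ler_wsqrtr // /norm1 sqrrD !real_normK ?num_real //.
by rewrite -addrA addrCA lerDr mulrn_wge0 // mulr_ge0.
Qed.

Lemma norm1_le_norm z : (norm1 z)%:C%C <= 2 * `|z|.
Proof.
rewrite normc_def -[2]/(2%:R) -(rmorph_nat (real_complex R) 2) -rmorphM lecR.
rewrite mulr_natl mulr2n lerD // -sqrtr_sqr ler_wsqrtr // ?lerDl ?lerDr sqr_ge0 //.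
Qed.

End Norm1.

Section ComplexDiff.
Context {R : realType}.
Implicit Types (f g : R[i] -> R[i]) (z w v L : R[i]).

(** A first-order expansion with real error bounds: it makes sense at [v = 0] too, and gives
    continuity and Lipschitz bounds without dividing by [v]. *)
Definition cdiff f z L := forall e : R, 0 < e -> exists2 d : R, 0 < d &
  forall v, norm1 v < d -> norm1 (f (z + v) - f z - L * v) <= e * norm1 v.

Lemma cdiffP f z L : is_derive (z : R[i]^o) 1 (f : R[i]^o -> R[i]^o) L <-> cdiff f z L.
Proof.
have E2 : (2 : R[i]) = (2 : R)%:C%C by rewrite rmorph_nat.
split.
  case=> df dl e e0.
  have : (fun h : R[i]^o => h^-1 *: ((f \o shift (z : R[i]^o)) (h *: (1 : R[i]^o)) - f z)) @ 0^' --> (L : R[i]^o).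
    by rewrite -dl; exact: df.
  (* Returning from the modulus to [norm1] doubles the error, which [e / 4] absorbs. *)
  move=> /(@cvgrPdist_le _ (R[i]^o) _ _ _ _ _).1 /(_ (e / 4)%:C%C); rewrite -(rmorph0 (real_complex R)) ltcR.
  rewrite divr_gt0 // => /(_ isT).
  rewrite near_withinE => /nbhs_ballP [d /= d0 H].
  have [r r0 rd] : exists2 r : R, 0 < r & r%:C%C = d.
    by case: (d) d0 => a b; rewrite ltcE /= => /andP[/eqP -> a0]; exists a.
  exists r => // v vr.
  have [->|v0] := eqVneq v 0.
    by rewrite addr0 mulr0 subrr subr0 norm1_0 mulr0.
  have {}H : `|L - v^-1 * (f (v + z) - f z)| <= (e / 4)%:C%C.
    have := H v; rewrite /ball /= sub0r normrN -rd.
    rewrite (le_lt_trans (norm_le_norm1 _)) ?ltcR // => /(_ isT v0).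
    by rewrite /= /shift -[v *: 1]/(v * 1) mulr1.
  have -> : f (z + v) - f z - L * v = - ((L - v^-1 * (f (v + z) - f z)) * v).
    by rewrite [v + z]addrC; field.
  rewrite norm1N -lecR (le_trans (norm1_le_norm _)) // normrM rmorphM /=.
  apply: (@le_trans _ _ (2 * ((e / 4)%:C%C * (norm1 v)%:C%C))).
    by rewrite ler_pM2l ?ltr0n // ler_pM // norm_le_norm1.
  by rewrite E2 -!rmorphM lecR mulrA ler_wpM2r ?norm1_ge0 //; lra.
move=> H.
suff lim : (fun h : R[i]^o => h^-1 *: ((f \o shift (z : R[i]^o)) (h *: (1 : R[i]^o)) - f z)) @ 0^' --> (L : R[i]^o).
  split; first by apply/cvg_ex; exists L.
  by apply/cvg_lim.
apply/(@cvgrPdist_le _ (R[i]^o)) => e e0.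
have [r r0 <-] : exists2 r : R, 0 < r & r%:C%C = e.
  by case: (e) e0 => a b; rewrite ltcE /= => /andP[/eqP -> a0]; exists a.
(* Halving the tolerance here and the radius below absorbs the factor 2 in [norm1 v <= 2 |v|]. *)
have [d d0 {}H] := H (r / 2) (divr_gt0 r0 (ltr0Sn _ _)).
rewrite near_withinE; apply/nbhs_ballP; exists (d / 2)%:C%C.
  by rewrite /= -(rmorph0 (real_complex R)) ltcR divr_gt0.
move=> v; rewrite /ball /= sub0r normrN => vd v0.
have nv : norm1 v < d.
  rewrite -ltcR (le_lt_trans (norm1_le_norm _)) //.
  have -> : d = 2 * (d / 2) by rewrite mulrC divfK.
  by rewrite rmorphM /= -E2 ltr_pM2l ?ltr0n.
have {}H := H _ nv.
rewrite /= /shift -[v *: 1]/(v * 1) mulr1 -[_ *: _]/(_ * _).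
have -> : L - v^-1 * (f (v + z) - f z) = - (v^-1 * (f (z + v) - f z - L * v)).
  by rewrite [v + z]addrC; field.
rewrite normrN normrM normfV ler_pdivrMl ?normr_gt0 //.
apply: (le_trans (norm_le_norm1 _)).
apply: (@le_trans _ _ ((r / 2)%:C%C * (norm1 v)%:C%C)).
  by rewrite -rmorphM lecR.
apply: (@le_trans _ _ ((r / 2)%:C%C * (2 * `|v|))).
  by rewrite ler_pM2l ?norm1_le_norm // -(rmorph0 (real_complex R)) ltcR divr_gt0.
by rewrite mulrA E2 -rmorphM divfK // mulrC.
Qed.

End ComplexDiff.

(** * Integrals of complex functions on a segment *)

Section ComplexContinuity.
Context {R : realType}.
Implicit Types (g h : R -> R[i]) (a b x : R).

Definition ccont g x := forall e : R, 0 < e -> exists2 d : R, 0 < d &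
  forall y, `|y - x| < d -> norm1 (g y - g x) <= e.

Lemma ccont_cst (c : R[i]) x : ccont (fun=> c) x.
Proof. by move=> e e0; exists 1 => // y _; rewrite subrr norm1_0 ltW. Qed.

Lemma ccontD g h x : ccont g x -> ccont h x -> ccont (fun y => g y + h y) x.
Proof.
move=> cg ch e e0; have e20 : 0 < e / 2 by rewrite divr_gt0.
have [d d0 Hg] := cg _ e20; have [d' d'0 Hh] := ch _ e20.
exists (Num.min d d'); first by rewrite lt_min d0.
move=> y; rewrite lt_min => /andP[yd yd'].
rewrite opprD addrACA (le_trans (norm1D _ _)) //.
have := Hg _ yd; have := Hh _ yd'; lra.
Qed.

Lemma ccontM g h x : ccont g x -> ccont h x -> ccont (fun y => g y * h y) x.
Proof.
move=> cg ch e e0; pose M := norm1 (g x) + norm1 (h x) + 1.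
have M0 : 1 <= M by rewrite lerDr addr_ge0 // norm1_ge0.
have M1 : 0 < M by exact: lt_le_trans M0.
(* The increment of the product is at most [e1 * (1 + norm1 (h x) + norm1 (g x))], the 1 coming from
   the product of both increments. *)
pose e1 := Num.min 1 (e / (2 * M)).
have e10 : 0 < e1 by rewrite lt_min ltr01 divr_gt0 // mulr_gt0.
have e1e : e1 * (2 * M) <= e.
  by rewrite -ler_pdivlMr ?mulr_gt0 // /e1 ge_min lexx orbT.
have e11 : e1 <= 1 by rewrite ge_min lexx.
have [d d0 Hg] := cg _ e10; have [d' d'0 Hh] := ch _ e10.
exists (Num.min d d'); first by rewrite lt_min d0.
move=> y; rewrite lt_min => /andP[yd yd'].
have {}Hg := Hg _ yd; have {}Hh := Hh _ yd'.
have -> : g y * h y - g x * h x = (g y - g x) * (h y - h x) +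
   ((g y - g x) * h x + g x * (h y - h x)) by ring.
have N1 := norm1M (g y - g x) (h y - h x).
have N2 := norm1M (g y - g x) (h x).
have N3 := norm1M (g x) (h y - h x).
have T1 := norm1D ((g y - g x) * (h y - h x))
   ((g y - g x) * h x + g x * (h y - h x)).
have T2 := norm1D ((g y - g x) * h x) (g x * (h y - h x)).
have B1 : norm1 (g y - g x) * norm1 (h y - h x) <= e1 * 1.
  by rewrite ler_pM ?norm1_ge0 // (le_trans Hh).
have B2 : norm1 (g y - g x) * norm1 (h x) <= e1 * norm1 (h x).
  by rewrite ler_wpM2r ?norm1_ge0.
have B3 : norm1 (g x) * norm1 (h y - h x) <= e1 * norm1 (g x).
  by rewrite mulrC ler_wpM2r ?norm1_ge0.
have : e1 * M <= e1 * (2 * M) by rewrite ler_pM2l //; lra.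
rewrite /M in e1e *; lra.
Qed.

Lemma ccont_Re g x : ccont g x -> {for x, continuous (fun y => Re (g y))}.
Proof.
move=> cg; apply/(@cvgrPdist_le _ R^o) => e e0.
have [d d0 H] := cg _ e0; apply/nbhs_ballP; exists d => //= y.
rewrite /ball /= distrC => /H; apply: le_trans.
by rewrite distrC -ReN -ReD Re_le_norm1.
Qed.

Lemma ccont_Im g x : ccont g x -> {for x, continuous (fun y => Im (g y))}.
Proof.
move=> cg; apply/(@cvgrPdist_le _ R^o) => e e0.
have [d d0 H] := cg _ e0; apply/nbhs_ballP; exists d => //= y.
rewrite /ball /= distrC => /H; apply: le_trans.
by rewrite distrC -ImN -ImD Im_le_norm1.
Qed.

Lemma ccont_ReIm (u v : R -> R) x : {for x, continuous u} -> {for x, continuous v} ->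
  ccont (fun y => (u y +i* v y)%C) x.
Proof.
move=> /(@cvgrPdist_le _ R^o) cu /(@cvgrPdist_le _ R^o) cv e e0.
have e20 : 0 < e / 2 by rewrite divr_gt0.
have /nbhs_ballP[d d0 Hu] := cu _ e20; have /nbhs_ballP[d' d'0 Hv] := cv _ e20.
exists (Num.min d d'); first by rewrite lt_min d0.
move=> y; rewrite lt_min => /andP[yd yd'].
have := Hu y; rewrite /ball /= distrC => /(_ yd) {}Hu.
have := Hv y; rewrite /ball /= distrC => /(_ yd') {}Hv.
rewrite /norm1 !ReImE /= distrC [X in _ + X]distrC; lra.
Qed.

Definition ccont_on g a b := forall x, a <= x <= b -> ccont g x.

Lemma ccont_onD g h a b : ccont_on g a b -> ccont_on h a b ->
  ccont_on (fun y => g y + h y) a b.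
Proof. by move=> G H x xab; apply: ccontD; [exact: G|exact: H]. Qed.

Lemma ccont_onM g h a b : ccont_on g a b -> ccont_on h a b ->
  ccont_on (fun y => g y * h y) a b.
Proof. by move=> G H x xab; apply: ccontM; [exact: G|exact: H]. Qed.

End ComplexContinuity.

Section ComplexIntegral.
Context {R : realType}.
Implicit Types (g h : R -> R[i]) (a b c : R) (u v : R -> R).
Notation mu := (@lebesgue_measure R).

Let within_seg u a b : (forall x, a <= x <= b -> {for x, continuous u}) ->
  {within `[a, b], continuous u}.
Proof.
move=> H; apply: continuous_in_subspaceT => x /set_mem /=.
by rewrite in_itv /= => /H.
Qed.

Let integrable_seg u a b : (forall x, a <= x <= b -> {for x, continuous u}) ->
  mu.-integrable `[a, b] (EFin \o u).
Proof.
move=> H; apply: continuous_compact_integrable; first exact: segment_compact.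
exact: within_seg.
Qed.

Let rint u a b : R := (\int[mu]_(x in `[a, b]) u x)%R.

Let rint_split u a b c : a <= b -> b <= c ->
  (forall x, a <= x <= c -> {for x, continuous u}) ->
  rint u a c = rint u a b + rint u b c.
Proof.
move=> ab bc H; apply/eqP; rewrite addrC -subr_eq; apply/eqP.
rewrite /rint (Rintegral_itvB (integrable_seg u a c H)) ?bnd_simp //.
apply: Rintegral_itv_obnd_cbnd; apply: integrableS (integrable_seg u a c H) => //.
by apply: subset_itvr; rewrite bnd_simp.
Qed.

Let rintD u v a b : (forall x, a <= x <= b -> {for x, continuous u}) ->
  (forall x, a <= x <= b -> {for x, continuous v}) ->
  rint (fun x => u x + v x) a b = rint u a b + rint v a b.
Proof. by move=> U V; apply: RintegralD => //; apply: integrable_seg. Qed.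

Let rintZ u a b k : (forall x, a <= x <= b -> {for x, continuous u}) ->
  rint (fun x => k * u x) a b = k * rint u a b.
Proof. by move=> U; apply: RintegralZl => //; apply: integrable_seg. Qed.

Let rint_bound u a b k : a <= b -> (forall x, a <= x <= b -> {for x, continuous u}) ->
  (forall x, a <= x <= b -> `|u x| <= k) -> `|rint u a b| <= k * (b - a).
Proof.
move=> ab U H; apply: (@le_trans _ _ (\int[mu]_(x in `[a, b]) `|u x|)%R).
  by apply: le_normr_Rintegral => //; exact: integrable_seg.
apply: (@le_trans _ _ (\int[mu]_(x in `[a, b]) k)%R).
  apply: le_Rintegral => //.
  - apply: (integrable_seg (fun x => `|u x|)) => x /U cx.
    exact: (cvg_norm cx).
  - apply: (integrable_seg (fun=> k)) => x _; exact: cvg_cst.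
suff E : fine (mu (`[a, b]%classic : set R)) = b - a.
  by rewrite (Rintegral_cst mu) // -E lexx.
rewrite lebesgue_measure_itv /= lte_fin.
move: ab; rewrite le_eqVlt => /predU1P[->|->]; last by [].
by rewrite ltxx subrr.
Qed.

Let rint_FTC u v a b : a <= b -> (forall x, {for x, continuous u}) ->
  (forall x : R, is_derive x 1 v (u x)) -> rint u a b = v b - v a.
Proof.
rewrite le_eqVlt => /predU1P[-> _ _|ab U V].
  by rewrite subrr /rint set_itv1 Rintegral_set1.
rewrite /rint /Rintegral (@continuous_FTC2 _ _ v) //.
- by apply: within_seg => x _.
- have cv : continuous v.
    by move=> x; apply/differentiable_continuous/derivable1_diffP; case: (V x).
  split.
  + by move=> x _; case: (V x).
  + by apply: cvg_at_right_filter; exact: cv.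
  + by apply: cvg_at_left_filter; exact: cv.
- by move=> x _; rewrite derive1E; case: (V x).
Qed.

Definition cint g a b : R[i] :=
  (rint (fun x => Re (g x)) a b +i* rint (fun x => Im (g x)) a b)%C.

Lemma eq_cint g h a b : (forall x, a <= x <= b -> g x = h x) -> cint g a b = cint h a b.
Proof.
move=> gh; rewrite /cint /rint; congr (_ +i* _)%C;
  by apply: eq_Rintegral => x /set_mem /=; rewrite in_itv /= => /gh ->.
Qed.

Lemma cint_split g a b c : a <= b -> b <= c -> ccont_on g a c ->
  cint g a c = cint g a b + cint g b c.
Proof.
move=> ab bc H; apply: complex_ext; rewrite !ReImE /=; apply: rint_split => // x /H.
- exact: ccont_Re.
- exact: ccont_Im.
Qed.

Lemma cintD g h a b : ccont_on g a b -> ccont_on h a b ->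
  cint (fun x => g x + h x) a b = cint g a b + cint h a b.
Proof.
move=> G H; apply: complex_ext; rewrite !ReImE /= -rintD;
  do ?by [move=> x /G/ccont_Re|move=> x /G/ccont_Im|move=> x /H/ccont_Re|move=> x /H/ccont_Im].
- by congr rint; apply/funext => x; rewrite ReD.
- by congr rint; apply/funext => x; rewrite ImD.
Qed.

Lemma cintZ (k : R[i]) g a b : ccont_on g a b ->
  cint (fun x => k * g x) a b = k * cint g a b.
Proof.
move=> G; have GR x : a <= x <= b -> {for x, continuous (fun y => Re (g y))}.
  by move=> /G/ccont_Re.
have GI x : a <= x <= b -> {for x, continuous (fun y => Im (g y))}.
  by move=> /G/ccont_Im.
have cZ (w : R) (p : R -> R) x : {for x, continuous p} -> {for x, continuous (fun y => w * p y)}.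
  by move=> cp; apply: (@cvgM _ R) => //; exact: cvg_cst.
apply: complex_ext; rewrite !ReImE /= -?mulNr -!rintZ // -rintD;
  do ?by move=> x /GR; apply: cZ.
all: do ?by move=> x /GI; apply: cZ.
- by congr rint; apply/funext => x; rewrite ReM mulNr.
- by congr rint; apply/funext => x; rewrite ImM.
Qed.

(** The factor 2 comes from bounding the real and imaginary integrals separately. *)
Lemma cint_bound g a b (k : R) : a <= b -> ccont_on g a b ->
  (forall x, a <= x <= b -> norm1 (g x) <= k) -> norm1 (cint g a b) <= 2 * k * (b - a).
Proof.
move=> ab G H; rewrite -mulrA mulr_natl mulr2n lerD // rint_bound //.
- by move=> x /G/ccont_Re.
- by move=> x /H; apply: le_trans; exact: Re_le_norm1.
- by move=> x /G/ccont_Im.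
- by move=> x /H; apply: le_trans; exact: Im_le_norm1.
Qed.

Lemma cint_FTC (u v U V : R -> R) a b : a <= b ->
  (forall x, {for x, continuous u}) -> (forall x, {for x, continuous v}) ->
  (forall x : R, is_derive x 1 U (u x)) -> (forall x : R, is_derive x 1 V (v x)) ->
  cint (fun x => u x +i* v x)%C a b = ((U b - U a) +i* (V b - V a))%C.
Proof. by move=> ab cu cv dU dV; rewrite /cint; congr (_ +i* _)%C; exact: rint_FTC. Qed.

End ComplexIntegral.

(** * Goursat's theorem on rectangles *)

Section Goursat.
Context {R : realType}.
Implicit Types (F : R[i] -> R[i]) (s t l p x y : R).

(** Tolerance 1 in [cdiff] yields [norm1 (F (z + v) - F z) <= (1 + norm1 L) * norm1 v] for small
    [v], used here along a horizontal line. *)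
Lemma cdiff_hcont F x y (L : R[i]) :
  cdiff F (x +i* y)%C L -> ccont (fun s => F (s +i* y)%C) x.
Proof.
move=> dF e e0; have [d d0 H] := dF 1 ltr01.
pose M := 1 + norm1 L.
have M0 : 0 < M by rewrite ltr_wpDr ?norm1_ge0.
exists (Num.min d (e / M)); first by rewrite lt_min d0 divr_gt0.
move=> s; rewrite lt_min ltr_pdivlMr // => /andP[sd seM].
have -> : (s +i* y)%C = (x +i* y)%C + ((s - x) +i* 0)%C.
  by apply: complex_ext; rewrite !ReImE /=; ring.
have nE : norm1 ((s - x) +i* 0)%C = `|s - x| by rewrite /norm1 /= normr0 addr0.
have := H ((s - x) +i* 0)%C; rewrite nE => /(_ sd).
set v := ((s - x) +i* 0)%C in nE *; set z := (x +i* y)%C => {}H.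
have -> : F (z + v) - F z = (F (z + v) - F z - L * v) + L * v by rewrite subrK.
have := norm1D (F (z + v) - F z - L * v) (L * v).
have := norm1M L v; rewrite nE /M in seM *; nra.
Qed.

Lemma cdiff_vcont F x y (L : R[i]) :
  cdiff F (x +i* y)%C L -> ccont (fun t => F (x +i* t)%C) y.
Proof.
move=> dF e e0; have [d d0 H] := dF 1 ltr01.
pose M := 1 + norm1 L.
have M0 : 0 < M by rewrite ltr_wpDr ?norm1_ge0.
exists (Num.min d (e / M)); first by rewrite lt_min d0 divr_gt0.
move=> s; rewrite lt_min ltr_pdivlMr // => /andP[sd seM].
have -> : (x +i* s)%C = (x +i* y)%C + (0 +i* (s - y))%C.
  by apply: complex_ext; rewrite !ReImE /=; ring.
have nE : norm1 (0 +i* (s - y))%C = `|s - y| by rewrite /norm1 /= normr0 add0r.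
have := H (0 +i* (s - y))%C; rewrite nE => /(_ sd).
set v := (0 +i* (s - y))%C in nE *; set z := (x +i* y)%C => {}H.
have -> : F (z + v) - F z = (F (z + v) - F z - L * v) + L * v by rewrite subrK.
have := norm1D (F (z + v) - F z - L * v) (L * v).
have := norm1M L v; rewrite nE /M in seM *; nra.
Qed.

Lemma ccont_real_affine (P Q : R[i]) x : ccont (fun y => P + Q * (y%:C)%C) x.
Proof.
apply: ccontD; first exact: ccont_cst.
apply: ccontM; first exact: ccont_cst.
by apply: (ccont_ReIm id (fun=> 0)); [exact: cvg_id|exact: cvg_cst].
Qed.

Lemma cint_affine (P Q : R[i]) (a b : R) : a <= b ->
  cint (fun x => P + Q * (x%:C)%C) a b =
  P * ((b - a)%:C)%C + Q * (((b ^+ 2 - a ^+ 2) / 2)%:C)%C.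
Proof.
move=> ab.
have E (u v : R) x : is_derive x 1 (fun y => u * y + v / 2 * y ^+ 2 : R) (u + v * x).
  apply: is_derive_eq; rewrite /GRing.scale /=; lra.
have Cn (u v : R) x : {for x, continuous (fun y => u + v * y : R)}.
  apply: (@cvgD _ R^o) ; first exact: cvg_cst.
  by apply: (@cvgM _ R); [exact: cvg_cst|exact: cvg_id].
rewrite (@eq_cint _ _ (fun x => ((Re P + Re Q * x) +i* (Im P + Im Q * x))%C)); last first.
  by move=> x _; apply: complex_ext; rewrite !ReImE /=; ring.
rewrite (@cint_FTC _ _ _ _ _ _ _ ab (Cn _ _) (Cn _ _) (E _ _) (E _ _)).
by apply: complex_ext; rewrite !ReImE /=; field.
Qed.

(** Counterclockwise boundary integral for the lower left corner [s + i t], width [l] and height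
    [p]: bottom minus top, plus [i] times right minus left. *)
Definition rect_bd F s l t p : R[i] :=
  cint (fun x => F (x +i* t)%C) s (s + l)
  - cint (fun x => F (x +i* (t + p))%C) s (s + l)
  + 'i%C * (cint (fun y => F ((s + l) +i* y)%C) t (t + p)
          - cint (fun y => F (s +i* y)%C) t (t + p)).

Definition cdiff_rect F s l t p := forall x y,
  s <= x <= s + l -> t <= y <= t + p -> exists L, cdiff F (x +i* y)%C L.

Lemma cdiff_rect_hcont F s l t p y : cdiff_rect F s l t p -> t <= y <= t + p ->
  ccont_on (fun x => F (x +i* y)%C) s (s + l).
Proof. by move=> H yt x xs; have [L /cdiff_hcont] := H _ _ xs yt. Qed.

Lemma cdiff_rect_vcont F s l t p x : cdiff_rect F s l t p -> s <= x <= s + l ->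
  ccont_on (fun y => F (x +i* y)%C) t (t + p).
Proof. by move=> H xs y yt; have [L /cdiff_vcont] := H _ _ xs yt. Qed.

(** Each inner side of the four quarters is run through twice, in opposite directions. *)
Lemma rect_bd_split F s l t p : 0 <= l -> 0 <= p ->
  cdiff_rect F s (2 * l) t (2 * p) ->
  rect_bd F s (2 * l) t (2 * p) =
  (rect_bd F s l t p + rect_bd F (s + l) l t p) +
  (rect_bd F s l (t + p) p + rect_bd F (s + l) l (t + p) p).
Proof.
move=> l0 p0 H; rewrite /rect_bd.
have es : s + 2 * l = s + l + l by ring.
have et : t + 2 * p = t + p + p by ring.
have hs y : t <= y <= t + 2 * p -> cint (fun x => F (x +i* y)%C) s (s + l + l) =
   cint (fun x => F (x +i* y)%C) s (s + l) + cint (fun x => F (x +i* y)%C) (s + l) (s + l + l).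
  move=> yt; apply: cint_split; [lra|lra|]; rewrite -es; exact: cdiff_rect_hcont yt.
have vs x : s <= x <= s + 2 * l -> cint (fun y => F (x +i* y)%C) t (t + p + p) =
   cint (fun y => F (x +i* y)%C) t (t + p) + cint (fun y => F (x +i* y)%C) (t + p) (t + p + p).
  move=> xs; apply: cint_split; [lra|lra|]; rewrite -et; exact: cdiff_rect_vcont xs.
rewrite es et !hs ?vs; [ring|lra..].
Qed.

Lemma norm1Mi (w : R[i]) : norm1 ('i%C * w) = norm1 w.
Proof. by rewrite /norm1 !ReImE /= !mul0r !mul1r sub0r add0r normrN addrC. Qed.

(** On the rectangle [F] is affine up to an error [k = e * (l + p)], since [l + p] bounds the
    [norm1] distance to [z0]. The affine part has boundary integral 0; the sides contribute errors
    [2 * k * l] and [2 * k * p], each twice. *)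
Lemma rect_bd_local F s l t p (z0 L : R[i]) (e : R) : 0 <= l -> 0 <= p -> 0 <= e ->
  cdiff_rect F s l t p ->
  s <= Re z0 <= s + l -> t <= Im z0 <= t + p ->
  (forall x y, s <= x <= s + l -> t <= y <= t + p ->
    norm1 (F (x +i* y)%C - F z0 - L * ((x +i* y)%C - z0)) <= e * norm1 ((x +i* y)%C - z0)) ->
  norm1 (rect_bd F s l t p) <= 4 * e * (l + p) ^+ 2.
Proof.
move=> l0 p0 e0 dF sz tz H.
(* [P y] and [Q x] are the parts of the affine approximation that stay constant along the horizontal
   line at [y] and the vertical line at [x]. *)
pose P y := F z0 - L * z0 + L * ('i%C * (y%:C)%C).
pose Q x := F z0 - L * z0 + L * (x%:C)%C.
pose k := e * (l + p).
have K x y : s <= x <= s + l -> t <= y <= t + p ->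
    norm1 (F (x +i* y)%C - F z0 - L * ((x +i* y)%C - z0)) <= k.
  move=> xs yt; apply: (le_trans (H _ _ xs yt)); rewrite ler_wpM2l // /norm1 lerD //.
    by rewrite !ReImE /= ler_norml; lra.
  by rewrite !ReImE /= ler_norml; lra.
have xyE x y : (x +i* y)%C = (x%:C)%C + 'i%C * (y%:C)%C.
  by apply: complex_ext; rewrite !ReImE /=; ring.
have hs y : t <= y <= t + p -> exists2 r, norm1 r <= 2 * k * l &
    cint (fun x => F (x +i* y)%C) s (s + l) =
      P y * (l%:C)%C + L * ((((s + l) ^+ 2 - s ^+ 2) / 2)%:C)%C + r.
  move=> yt.
  have ca : ccont_on (fun x => P y + L * (x%:C)%C) s (s + l).
    by move=> x _; exact: ccont_real_affine.
  have cF := cdiff_rect_hcont _ _ _ _ _ _ dF yt.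
  have cN : ccont_on (fun x => F (x +i* y)%C + (-1) * (P y + L * (x%:C)%C)) s (s + l).
    apply: ccont_onD => //; apply: ccont_onM => // x _; exact: ccont_cst.
  exists (cint (fun x => F (x +i* y)%C + (-1) * (P y + L * (x%:C)%C)) s (s + l)).
    have {2}-> : l = s + l - s by ring.
    apply: cint_bound => //; first lra.
    move=> x xs; have := K x y xs yt; congr (norm1 _ <= _); rewrite /P xyE; ring.
  rewrite cintD //; last by apply: ccont_onM => // x _; exact: ccont_cst.
  rewrite cintZ // cint_affine ?lerDl //.
  have -> : s + l - s = l by ring.
  ring.
have vs x : s <= x <= s + l -> exists2 r, norm1 r <= 2 * k * p &
    cint (fun y => F (x +i* y)%C) t (t + p) =
      Q x * (p%:C)%C + L * 'i%C * ((((t + p) ^+ 2 - t ^+ 2) / 2)%:C)%C + r.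
  move=> xs.
  have ca : ccont_on (fun y => Q x + L * 'i%C * (y%:C)%C) t (t + p).
    by move=> y _; exact: ccont_real_affine.
  have cF := cdiff_rect_vcont _ _ _ _ _ _ dF xs.
  have cN : ccont_on (fun y => F (x +i* y)%C + (-1) * (Q x + L * 'i%C * (y%:C)%C)) t (t + p).
    apply: ccont_onD => //; apply: ccont_onM => // y _; exact: ccont_cst.
  exists (cint (fun y => F (x +i* y)%C + (-1) * (Q x + L * 'i%C * (y%:C)%C)) t (t + p)).
    have {2}-> : p = t + p - t by ring.
    apply: cint_bound => //; first lra.
    move=> y yt; have := K x y xs yt; congr (norm1 _ <= _); rewrite /Q xyE; ring.
  rewrite cintD //; last by apply: ccont_onM => // y _; exact: ccont_cst.
  rewrite cintZ // cint_affine ?lerDl //.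
  have -> : t + p - t = p by ring.
  ring.
have [|r1 n1 E1] := hs t; first by lra.
have [|r2 n2 E2] := hs (t + p); first by lra.
have [|r3 n3 E3] := vs (s + l); first by lra.
have [|r4 n4 E4] := vs s; first by lra.
(* The affine terms leave [- L i p l] from the horizontal sides and [i L l p] from the vertical
   ones. *)
have -> : rect_bd F s l t p = r1 - r2 + 'i%C * (r3 - r4).
  rewrite /rect_bd E1 E2 E3 E4 /P /Q.
  move: (((s + l) ^+ 2 - s ^+ 2) / 2) (((t + p) ^+ 2 - t ^+ 2) / 2) => u v.
  by rewrite !rmorphD /=; ring.
have := norm1D (r1 - r2) ('i%C * (r3 - r4)); rewrite norm1Mi.
have := norm1B r1 r2; have := norm1B r3 r4.
have -> : 4 * e * (l + p) ^+ 2 = 4 * k * (l + p) by rewrite /k; ring.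
lra.
Qed.

(** Four quarters each below [c] would add up to less than [4 * c]. *)
Lemma rect_bisect F s l t p (c : R) : 0 <= l -> 0 <= p ->
  cdiff_rect F s (2 * l) t (2 * p) ->
  4 * c <= norm1 (rect_bd F s (2 * l) t (2 * p)) ->
  exists s' t', [/\ s <= s' /\ s' + l <= s + 2 * l, t <= t' /\ t' + p <= t + 2 * p &
    c <= norm1 (rect_bd F s' l t' p)].
Proof.
move=> l0 p0 H; rewrite rect_bd_split // => Hc.
have [s1 s2] : s <= s + l /\ s + l <= s + 2 * l by split; lra.
have [t1 t2] : t <= t + p /\ t + p <= t + 2 * p by split; lra.
have s3 : s + l + l <= s + 2 * l by lra.
have t3 : t + p + p <= t + 2 * p by lra.
have [h|h1] := leP c (norm1 (rect_bd F s l t p)); first by exists s, t.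
have [h|h2] := leP c (norm1 (rect_bd F (s + l) l t p)); first by exists (s + l), t.
have [h|h3] := leP c (norm1 (rect_bd F s l (t + p) p)); first by exists s, (t + p).
have [h|h4] := leP c (norm1 (rect_bd F (s + l) l (t + p) p)).
  by exists (s + l), (t + p).
exfalso; move: Hc h1 h2 h3 h4; clear.
move: (rect_bd F s l t p) (rect_bd F (s + l) l t p) (rect_bd F s l (t + p) p)
  (rect_bd F (s + l) l (t + p) p) => w1 w2 w3 w4.
have := norm1D (w1 + w2) (w3 + w4); have := norm1D w1 w2; have := norm1D w3 w4.
lra.
Qed.

End Goursat.

(** * Bisection and the vanishing of the boundary integral *)

Section NestedRectangles.
Context {R : realType}.
Implicit Types (F : R[i] -> R[i]) (s t l p x y : R).

(** The common point is the supremum of the left ends, as every right end bounds them all. *)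
Lemma nested_segments (u w : nat -> R) : (forall n, 0 <= w n) ->
  (forall n, u n <= u n.+1) -> (forall n, u n.+1 + w n.+1 <= u n + w n) ->
  exists x, forall n, u n <= x <= u n + w n.
Proof.
move=> w0 uS wS.
have u_le m n : (m <= n)%N -> u m <= u n.
  by move=> /subnK <-; elim: (n - m)%N => // i IH; rewrite addSn (le_trans IH).
have w_le m n : (m <= n)%N -> u n + w n <= u m + w m.
  by move=> /subnK <-; elim: (n - m)%N => // i IH; rewrite addSn (le_trans (wS _)).
have uw m n : u n <= u m + w m.
  have [mn|/ltnW nm] := leqP m n.
    by apply: le_trans (w_le _ _ mn); rewrite lerDl.
  by apply: (le_trans (u_le _ _ nm)); rewrite lerDl.
exists (sup (range u)) => n; apply/andP; split.
  apply: ub_le_sup; last by exists n.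
  by exists (u 0%N + w 0%N) => _ [m _ <-].
apply: ge_sup; first by exists (u 0%N), 0%N.
by move=> _ [m _ <-].
Qed.

Lemma halving_lt (c d : R) : 0 < d -> exists n, c * 2^-1 ^+ n < d.
Proof.
move=> d0; have [c0|c0] := leP c 0.
  exists 0%N; rewrite expr0 mulr1; exact: le_lt_trans c0 d0.
exists (Num.bound (c / d)).
have Hb : c / d < (Num.bound (c / d))%:R.
  by apply: archi_boundP; rewrite divr_ge0 // ltW.
rewrite exprVn ltr_pdivrMr ?exprn_gt0 // mulrC -ltr_pdivrMr //.
apply: (lt_le_trans Hb); rewrite -natrX ler_nat; exact/ltnW/ltn_expl.
Qed.

Theorem goursat_rect F s l t p : 0 <= l -> 0 <= p -> cdiff_rect F s l t p ->
  rect_bd F s l t p = 0.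
Proof.
move=> l0 p0 H; apply: norm1_eq0; apply/eqP; apply: contraT => nz.
set eta := norm1 _ in nz.
have eta0 : 0 < eta by rewrite lt_neqAle eq_sym nz norm1_ge0.
pose ln n := l * 2^-1 ^+ n; pose pn n := p * 2^-1 ^+ n.
have ln0 n : 0 <= ln n by rewrite mulr_ge0 // exprn_ge0 // invr_ge0.
have pn0 n : 0 <= pn n by rewrite mulr_ge0 // exprn_ge0 // invr_ge0.
have lnS n : 2 * ln n.+1 = ln n.
  by rewrite /ln exprS mulrCA [2 * _]mulrA divff ?mul1r // pnatr_eq0.
have pnS n : 2 * pn n.+1 = pn n.
  by rewrite /pn exprS mulrCA [2 * _]mulrA divff ?mul1r // pnatr_eq0.
(* Bisection invariant: the rectangle lies in the original one and its boundary integral is at least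
   [eta * 4^-n]. *)
pose inside n (q : R * R) := [/\ s <= q.1, q.1 + ln n <= s + l, t <= q.2,
  q.2 + pn n <= t + p & eta * 4^-1 ^+ n <= norm1 (rect_bd F q.1 (ln n) q.2 (pn n))].
pose sub n (q q' : R * R) := [/\ q.1 <= q'.1, q'.1 + ln n.+1 <= q.1 + ln n,
  q.2 <= q'.2 & q'.2 + pn n.+1 <= q.2 + pn n].
have step n q : inside n q -> exists q', inside n.+1 q' /\ sub n q q'.
  case=> q1 q2 q3 q4 q5.
  have dF : cdiff_rect F q.1 (2 * ln n.+1) q.2 (2 * pn n.+1).
    by rewrite lnS pnS => x y xq yq; apply: H; lra.
  have E4 : 4 * (eta * 4^-1 ^+ n.+1) <= norm1 (rect_bd F q.1 (2 * ln n.+1) q.2 (2 * pn n.+1)).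
    rewrite lnS pnS; apply: le_trans q5; rewrite exprS; lra.
  have [s' [t' [[a1 a2] [b1 b2] c]]] := rect_bisect _ _ _ _ _ _ (ln0 _) (pn0 _) dF E4.
  rewrite lnS in a2; rewrite pnS in b2.
  by exists (s', t'); split; split => //=; lra.
(* Choice makes [step] a function; the default [q] is returned only where no successor exists, which
   [nextP] excludes under [inside]. *)
pose next n q := if pselect (exists q', inside n.+1 q' /\ sub n q q') is left e
  then projT1 (cid e) else q.
have nextP n q : inside n q -> inside n.+1 (next n q) /\ sub n q (next n q).
  move=> /step ex; rewrite /next; case: pselect => // e; exact: (projT2 (cid e)).
pose Q := fix Q n := if n is n'.+1 then next n' (Q n') else (s, t).
have QP n : inside n (Q n).
  elim: n => [|n /nextP[]//]; rewrite /inside /ln /pn /= expr0 !mulr1.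
  by split => //=.
have QS n : sub n (Q n) (Q n.+1) by case: (nextP n (Q n) (QP n)).
have [x0 xP] : exists x, forall n, (Q n).1 <= x <= (Q n).1 + ln n.
  by apply: nested_segments => // n; case: (QS n).
have [y0 yP] : exists y, forall n, (Q n).2 <= y <= (Q n).2 + pn n.
  by apply: nested_segments => // n; case: (QS n).
have [L dL] : exists L, cdiff F (x0 +i* y0)%C L.
  apply: H; first by have := xP 0%N; rewrite /ln expr0 mulr1.
  by have := yP 0%N; rewrite /pn expr0 mulr1.
(* The final comparison becomes [2 * K <= (l + p)^2], which is absurd; adding 1 keeps [K] positive
   even if [l + p = 0]. *)
pose K := (l + p) ^+ 2 + 1.
have K0 : 0 < K by rewrite ltr_wpDl ?sqr_ge0.
have e0 : 0 < eta / (8 * K) by rewrite divr_gt0 // mulr_gt0.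
have [d d0 Hd] := dL _ e0.
have [n nd] := halving_lt (l + p) d d0.
case: (QP n) => q1 q2 q3 q4 q5.
have : norm1 (rect_bd F (Q n).1 (ln n) (Q n).2 (pn n)) <=
    4 * (eta / (8 * K)) * (ln n + pn n) ^+ 2.
  apply: (@rect_bd_local _ _ _ _ _ _ (x0 +i* y0)%C L) => //; first exact: ltW.
    by move=> x y xq yq; apply: H; lra.
  move=> x y xq yq; set v := (x +i* y)%C - (x0 +i* y0)%C.
  have -> : (x +i* y)%C = (x0 +i* y0)%C + v by rewrite addrC subrK.
  apply: Hd; apply: le_lt_trans nd; rewrite mulrDl /norm1 /v !ReImE /= lerD //.
    by rewrite -/(ln n) ler_norml; have := xP n; lra.
  by rewrite -/(pn n) ler_norml; have := yP n; lra.
move=> /(le_trans q5).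
have -> : (ln n + pn n) ^+ 2 = (l + p) ^+ 2 * 4^-1 ^+ n.
  rewrite /ln /pn -mulrDl exprMn -exprM mulnC exprM; congr (_ * _ ^+ _).
  by rewrite expr2 -invfM -natrM.
rewrite mulrA ler_pM2r ?exprn_gt0 ?invr_gt0 //.
have -> : 4 * (eta / (8 * K)) * (l + p) ^+ 2 = eta * ((l + p) ^+ 2 / (2 * K)).
  by field; rewrite gt_eqF.
rewrite ler_pMr // ler_pdivlMr ?mulr_gt0 // /K => h.
have := sqr_ge0 (l + p); lra.
Qed.

End NestedRectangles.

(** * Cauchy's formula for the derivative *)

Lemma is_derive1_compN (K : numFieldType) (f g : K -> K) (x df dg : K) :
  is_derive x 1 f df -> is_derive (f x) 1 g dg ->
  is_derive x 1 (fun y => g (f y)) (dg * df).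
Proof.
case=> /derivable1_diffP ef <- [/derivable1_diffP eg <-].
have dgf : differentiable (g \o f) x by exact: differentiable_comp.
split; first exact/derivable1_diffP.
rewrite -derive1E -[fun _ => _]/(g \o f) derive1E' // diff_comp // -!derive1E !derive1E' //=.
by rewrite -[X in 'd _ _ X = _]mulr1 [LHS]linearZ mulrC.
Qed.

Section RealDiff.
Context {R : realType}.

Lemma rdiffP (g : R -> R) (x l : R) : is_derive x 1 g l <->
  forall e : R, 0 < e -> exists2 d : R, 0 < d &
    forall v, `|v| < d -> `|g (x + v) - g x - l * v| <= e * `|v|.
Proof.
split.
  case=> df dl e e0.
  have : (fun h : R^o => h^-1 *: ((g \o shift (x : R^o)) (h *: (1 : R^o)) - g x)) @ 0^' --> (l : R^o).
    by rewrite -dl; exact: df.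
  move=> /(@cvgrPdist_le _ (R^o)) /(_ _ e0).
  rewrite near_withinE => /nbhs_ballP [d /= d0 H].
  exists d => // v vr.
  have [->|v0] := eqVneq v 0.
    by rewrite addr0 mulr0 subrr subr0 normr0 mulr0.
  have {}H : `|l - v^-1 * (g (v + x) - g x)| <= e.
    have := H v; rewrite /ball /= sub0r normrN => /(_ vr v0).
    by rewrite /= /shift -[v *: 1]/(v * 1) mulr1.
  have -> : g (x + v) - g x - l * v = - ((l - v^-1 * (g (v + x) - g x)) * v).
    by rewrite [v + x]addrC; field.
  by rewrite normrN normrM ler_wpM2r.
move=> H.
suff lim : (fun h : R^o => h^-1 *: ((g \o shift (x : R^o)) (h *: (1 : R^o)) - g x)) @ 0^' --> (l : R^o).
  split; first by apply/cvg_ex; exists l.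
  by apply/cvg_lim.
apply/(@cvgrPdist_le _ (R^o)) => e e0.
have [d d0 {}H] := H e e0.
rewrite near_withinE; apply/nbhs_ballP; exists d => // v.
rewrite /ball /= sub0r normrN => vd v0.
have {}H := H _ vd.
rewrite /= /shift -[v *: 1]/(v * 1) mulr1 -[_ *: _]/(_ * _).
have -> : l - v^-1 * (g (v + x) - g x) = - (v^-1 * (g (x + v) - g x - l * v)).
  by rewrite [v + x]addrC; field.
by rewrite normrN normrM normfV ler_pdivrMl ?normr_gt0 // [leRHS]mulrC.
Qed.

End RealDiff.

(** * The complex exponential *)

Section ComplexExp.
Context {R : realType}.
Implicit Types (z w : R[i]) (s t : R).

Definition cexp z : R[i] :=
  ((expR (Re z) * cos (Im z)) +i* (expR (Re z) * sin (Im z)))%C.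

Lemma cexpD z w : cexp (z + w) = cexp z * cexp w.
Proof.
by apply: complex_ext; rewrite !ReImE /= !ReImE expRD ?cosD ?sinD; ring.
Qed.

Lemma cexp0 : cexp 0 = 1.
Proof. by apply: complex_ext; rewrite /= expR0 ?cos0 ?sin0 ?mulr0 ?mulr1. Qed.

Lemma cexpNr z : cexp z * cexp (- z) = 1.
Proof. by rewrite -cexpD subrr cexp0. Qed.

Lemma norm1_cexp z : norm1 (cexp z) <= 2 * expR (Re z).
Proof.
rewrite /norm1 /= !normrM (ger0_norm (expR_ge0 _)).
have c1 : `|cos (Im z)| <= 1 by rewrite ler_norml cos_geN1 cos_le1.
have s1 : `|sin (Im z)| <= 1 by rewrite ler_norml sin_geN1 sin_le1.
have := expR_ge0 (Re z); nra.
Qed.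

Lemma cexp_period s t : cexp (s +i* (t + pi *+ 2))%C = cexp (s +i* t)%C.
Proof. by rewrite /cexp /= cosD2pi sinD2pi. Qed.

Lemma cdiff_cexp0 : cdiff cexp 0 1.
Proof.
move=> e e0.
have /rdiffP dE : is_derive (0 : R) 1 (@expR R) 1.
  by have := is_derive_expR (0 : R); rewrite expR0.
have /rdiffP dC : is_derive (0 : R) 1 (@cos R) 0.
  by have := is_derive_cos (0 : R); rewrite sin0 oppr0.
have /rdiffP dS : is_derive (0 : R) 1 (@sin R) 1.
  by have := is_derive_sin (0 : R); rewrite cos0.
(* With [v = a + i b] the errors add up to at most [q |a| + 8 q |b|]. Requiring [norm1 v < q] as
   well makes the cross term [b (exp a - 1)] small. *)
pose q := Num.min 1 (e / 10).
have q0 : 0 < q by rewrite lt_min ltr01 divr_gt0.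
have q1 : q <= 1 by rewrite ge_min lexx.
have qe : q * 10 <= e by rewrite -ler_pdivlMr // ge_min lexx orbT.
clearbody q.
have [d1 d10 HE] := dE q q0; have [d2 d20 HC] := dC q q0; have [d3 d30 HS] := dS q q0.
exists (Num.min (Num.min d1 d2) (Num.min d3 q)).
  by rewrite !lt_min d10 d20 d30 q0.
move=> v; rewrite !lt_min => /andP[/andP[v1 v2] /andP[v3 v4]].
rewrite add0r cexp0 mul1r.
have ra := Re_le_norm1 v; have ib := Im_le_norm1 v.
have := HE (Re v); rewrite add0r expR0 mul1r => /(_ (le_lt_trans ra v1)) {}HE.
have := HC (Im v); rewrite add0r cos0 mul0r subr0 => /(_ (le_lt_trans ib v2)) {}HC.
have := HS (Im v); rewrite add0r sin0 mul1r subr0 => /(_ (le_lt_trans ib v3)) {}HS.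
have aq : `|Re v| < q by exact: le_lt_trans ra v4.
set a := Re v in HE aq *; set b := Im v in HC HS *.
have Ea : `|expR a - 1| <= 2 * `|a|.
  have -> : expR a - 1 = (expR a - 1 - a) + a by rewrite subrK.
  apply: (le_trans (ler_normD _ _)); have := normr_ge0 a; nra.
have E3 : `|expR a| <= 3.
  have -> : expR a = (expR a - 1) + 1 by rewrite subrK.
  apply: (le_trans (ler_normD _ _)); rewrite normr1; lra.
have e1 : `|expR a * (cos b - 1)| <= 3 * (q * `|b|) by rewrite normrM ler_pM.
have e2 : `|expR a * (sin b - b)| <= 3 * (q * `|b|) by rewrite normrM ler_pM.
have e3 : `|b * (expR a - 1)| <= `|b| * (2 * q).
  by rewrite normrM ler_wpM2l // (le_trans Ea) //; lra.
rewrite {1}/norm1 !ReImE /= -/a -/b oppr0 addr0.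
have -> : expR a * cos b - 1 - a = expR a * (cos b - 1) + (expR a - 1 - a) by ring.
have -> : expR a * sin b - b = expR a * (sin b - b) + b * (expR a - 1) by ring.
have t1 := ler_normD (expR a * (cos b - 1)) (expR a - 1 - a).
have t2 := ler_normD (expR a * (sin b - b)) (b * (expR a - 1)).
have : q * 10 * norm1 v <= e * norm1 v by rewrite ler_wpM2r ?norm1_ge0.
rewrite /norm1 -/a -/b.
have : 0 <= q * `|a| by rewrite mulr_ge0 // ltW.
have : 0 <= q * `|b| by rewrite mulr_ge0 // ltW.
lra.
Qed.

(** The functional equation carries the expansion at 0 to [z]. *)
Lemma cdiff_cexp z : cdiff cexp z (cexp z).
Proof.
move=> e e0; pose M := norm1 (cexp z) + 1.
have M0 : 0 < M by rewrite ltr_wpDl ?norm1_ge0.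
have [d d0 H] := cdiff_cexp0 (e / M) (divr_gt0 e0 M0).
exists d => // v /H; rewrite add0r cexp0 mul1r => {}H.
have -> : cexp (z + v) - cexp z - cexp z * v = cexp z * (cexp v - 1 - v).
  by rewrite cexpD; ring.
apply: (le_trans (norm1M _ _)).
apply: (@le_trans _ _ (M * (e / M * norm1 v))).
  by rewrite ler_pM ?norm1_ge0 // lerDl.
by rewrite mulrA [M * _]mulrC divfK ?gt_eqF.
Qed.

(** Removes the constant term from Cauchy's formula: the kernel of a constant function is a multiple
    of [cexp (- u)]. *)
Lemma cint_cexpN s : cint (fun t => cexp (- (s +i* t)%C)) 0 (pi *+ 2) = 0.
Proof.
pose k := expR (- s).
have dS (c x : R) : is_derive x 1 (fun t => c * sin t : R) (c * cos x).
  by apply: is_derive_eq; rewrite /GRing.scale /= mulrC; ring.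
have dC (c x : R) : is_derive x 1 (fun t => c * cos t : R) (- c * sin x).
  by apply: is_derive_eq; rewrite /GRing.scale /=; ring.
have cv (g g' : R -> R) : (forall x, is_derive (x : R) 1 g (g' x)) -> forall x, {for x, continuous g}.
  by move=> dg x; apply/differentiable_continuous/derivable1_diffP; case: (dg x).
rewrite (@eq_cint _ _ (fun t => ((k * cos t) +i* (- k * sin t))%C)); last first.
  by move=> t _; apply: complex_ext; rewrite /= ?cosN ?sinN ?mulrN ?mulNr.
have pi0 : 0 <= (pi *+ 2 : R) by rewrite mulrn_wge0 // pi_ge0.
rewrite (@cint_FTC _ _ _ _ _ _ _ pi0 (cv _ _ (dC k)) (cv _ _ (dS (- k))) (dS k) (dC k)).
by rewrite sin0 cos0 sin2pi cos2pi !subrr.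
Qed.

End ComplexExp.

Section CauchyDerivative.
Context {R : realType}.
Implicit Types (f : R[i] -> R[i]) (z : R[i]) (s t S : R).

Definition circle_kernel f z (u : R[i]) : R[i] := f (z + cexp u) * cexp (- u).

Lemma cdiff_circle_kernel f z u (L : R[i]) : cdiff f (z + cexp u) L ->
  exists L', cdiff (circle_kernel f z) u L'.
Proof.
move=> /cdiffP df; have /cdiffP dE := cdiff_cexp u.
have /cdiffP dN := cdiff_cexp (- u).
have dA : is_derive (u : R[i]^o) 1 (fun w : R[i]^o => (z : R[i]^o) + cexp w) (cexp u).
  by apply: is_derive_eq; rewrite add0r.
have dM : is_derive (u : R[i]^o) 1 (fun w : R[i]^o => cexp (- w) : R[i]^o) (cexp (- u) * (-1)).
  by apply: (@is_derive1_compN (R[i]) -%R cexp) dN.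
have d1 := @is_derive1_compN (R[i]) _ _ _ _ _ dA df.
have d2 := is_deriveM d1 dM.
by eexists; apply/cdiffP; exact: d2.
Qed.

(* Cauchy's formula for [f' z]: in the coordinate [w = z + exp u] the kernel
   [f w / (w - z)^2 dw] becomes [circle_kernel f z u du], which has period 2 pi i. *)
Lemma cauchy_derivative f z S (L : R[i]) :
  (forall v, norm1 v <= 2 * expR S -> exists L', cdiff f (z + v) L') ->
  cdiff f z L ->
  cint (fun t => circle_kernel f z (S +i* t)%C) 0 (pi *+ 2) = ((pi *+ 2)%:C)%C * L.
Proof.
move=> df dz.
have pi0 : 0 <= (pi *+ 2 : R) by rewrite mulrn_wge0 // pi_ge0.
have dG s t : s <= S -> exists L', cdiff (circle_kernel f z) (s +i* t)%C L'.
  move=> sS; have [|L' /cdiff_circle_kernel//] := df (cexp (s +i* t)%C).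
  by rewrite (le_trans (norm1_cexp _)) // ler_pM2l // ler_expR.
(* Goursat on [[s, S] x [0, 2 pi]]: the horizontal sides cancel by periodicity, so the vertical ones
   agree and the radius [exp S] may shrink to [exp s]. *)
have indep s : s <= S -> cint (fun t => circle_kernel f z (S +i* t)%C) 0 (pi *+ 2) =
    cint (fun t => circle_kernel f z (s +i* t)%C) 0 (pi *+ 2).
  move=> sS; have := goursat_rect (circle_kernel f z) s (S - s) 0 (pi *+ 2).
  rewrite subr_ge0 => /(_ sS pi0); rewrite /cdiff_rect /rect_bd addrC subrK add0r.
  have -> : (fun x => circle_kernel f z (x +i* (pi *+ 2))%C) = (fun x => circle_kernel f z (x +i* 0)%C).
    apply/funext => x; rewrite /circle_kernel -[pi *+ 2]add0r cexp_period; congr (_ * _).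
    (* The period of [cexp (- u)] follows from that of [cexp u] by uniqueness of inverses. *)
    have := cexpNr (x +i* 0)%C; rewrite -cexp_period => H1.
    have H2 := cexpNr (x +i* (0 + pi *+ 2))%C.
    have nz : cexp (x +i* (0 + pi *+ 2))%C != 0.
      by apply: contra_eq_neq H2 => ->; rewrite mul0r eq_sym oner_eq0.
    by apply: (mulfI nz); rewrite H2 H1.
  rewrite subrr add0r => H.
  have /eqP : 'i%C * (cint (fun y => circle_kernel f z (S +i* y)%C) 0 (pi *+ 2) -
     cint (fun y => circle_kernel f z (s +i* y)%C) 0 (pi *+ 2)) = 0.
    by apply: H => x y /andP[_ xS] _; exact: dG.
  have i0 : 'i%C != 0 :> R[i] by rewrite eq_complex /= oner_eq0 andbF.
  by rewrite mulf_eq0 (negbTE i0) /= subr_eq0 => /eqP.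
set V := cint _ _ _ in indep *.
apply/eqP; rewrite -subr_eq0; apply/eqP; apply: norm1_eq0; apply/eqP.
rewrite eq_le norm1_ge0 andbT; apply/ler_addgt0Pr => e e0; rewrite add0r.
(* The integrand [r] below has [norm1] at most [4 * q], hence its integral at most [8 * q * 2 pi],
   which is below [e]. *)
pose q := e / (8 * (pi *+ 2 + 1)).
have q0 : 0 < q by rewrite divr_gt0 // mulr_gt0 // ltr_wpDl.
have [d d0 H] := dz q q0.
(* Small enough that [norm1 (cexp u) <= 2 * expR s <= d / 2] on the circle. *)
pose s := Num.min S (ln (d / 4)).
have sS : s <= S by rewrite ge_min lexx.
have sd : expR s <= d / 4.
  have d40 : 0 < d / 4 by rewrite divr_gt0.
  by rewrite -[leRHS]lnK ?posrE // ler_expR ge_min lexx orbT.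
rewrite (indep s sS).
have cG : ccont_on (fun t => circle_kernel f z (s +i* t)%C) 0 (pi *+ 2).
  by move=> t _; have [L' /cdiff_vcont] := dG s t sS.
have cE : ccont_on (fun t => cexp (- (s +i* t)%C)) 0 (pi *+ 2).
  move=> t _; apply: (@cdiff_vcont _ (fun u => cexp (- u)) _ _ (cexp (- (s +i* t)%C) * (-1))).
  have /cdiffP dN := cdiff_cexp (- (s +i* t)%C).
  by apply/cdiffP; apply: (@is_derive1_compN (R[i]) -%R cexp) dN.
(* The constant [L] is written as an affine function so that [cint_affine] evaluates its
   integral. *)
have cA : ccont_on (fun t : R => L + 0 * (t%:C)%C) 0 (pi *+ 2).
  by move=> t _; exact: ccont_real_affine.
have cK k : ccont_on (fun t : R => k : R[i]) 0 (pi *+ 2).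
  by move=> t _; exact: ccont_cst.
pose r t := circle_kernel f z (s +i* t)%C + (- f z * cexp (- (s +i* t)%C)
   + (-1) * (L + 0 * (t%:C)%C)).
have cT : ccont_on (fun t => - f z * cexp (- (s +i* t)%C)
   + (-1) * (L + 0 * (t%:C)%C)) 0 (pi *+ 2).
  by apply: ccont_onD; apply: ccont_onM.
have cr : ccont_on r 0 (pi *+ 2) by apply: ccont_onD.
have : cint r 0 (pi *+ 2) = cint (fun t => circle_kernel f z (s +i* t)%C) 0 (pi *+ 2)
    - ((pi *+ 2)%:C)%C * L.
  rewrite cintD // cintD; [|exact: ccont_onM..].
  by rewrite !cintZ // cint_cexpN cint_affine // subr0; ring.
move=> <-.
apply: (@le_trans _ _ (2 * (4 * q) * (pi *+ 2 - 0))); last first.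
  rewrite subr0 [2 * (4 * q)]mulrA.
  have -> : e = 2 * 4 * q * (pi *+ 2 + 1).
    have : pi *+ 2 + 1 != 0 :> R by rewrite gt_eqF // ltr_wpDl.
    by rewrite /q; move: (pi *+ 2 + 1) => P P0; field.
  by rewrite ler_pM2l ?lerDl ?ler01 // mulr_gt0 //; lra.
apply: cint_bound => // t _.
set u := (s +i* t)%C.
have nu : norm1 (cexp u) <= 2 * expR s by have := norm1_cexp u.
have nu' : norm1 (cexp (- u)) <= 2 / expR s by have := norm1_cexp (- u); rewrite /= expRN.
have -> : r t = (f (z + cexp u) - f z - L * cexp u) * cexp (- u).
  rewrite /r /circle_kernel -/u mul0r addr0 !mulrBl -[L * cexp u * _]mulrA cexpNr; ring.
have ud : norm1 (cexp u) < d by rewrite (le_lt_trans nu) //; lra.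
apply: (le_trans (norm1M _ _)).
apply: (@le_trans _ _ (q * (2 * expR s) * (2 / expR s))).
  rewrite ler_pM ?norm1_ge0 // (le_trans (H _ ud)) // ler_wpM2l // ltW //.
have := expR_gt0 s => h; rewrite le_eqVlt; apply/orP; left; apply/eqP.
by field; rewrite gt_eqF.
Qed.

End CauchyDerivative.

(** * Differentiability of the derivative *)

Section SecondDerivative.
Context {R : realType}.
Implicit Types (f : R[i] -> R[i]) (z v w : R[i]).

Lemma norm1_realM (x : R) w : norm1 ((x%:C)%C * w) = `|x| * norm1 w.
Proof. by rewrite /norm1 !ReImE /= !mul0r subr0 addr0 !normrM mulrDr. Qed.

(** The real mean value theorem for the real and the imaginary part of [t -> f (z + t v) - A t v] on
    [[0, 1]]; adding the two bounds gives the factor 2. *)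
Lemma cdiff_segment f f' z v (A : R[i]) (K : R) :
  (forall t : R, 0 <= t <= 1 -> cdiff f (z + (t%:C)%C * v) (f' (z + (t%:C)%C * v))) ->
  (forall t : R, 0 <= t <= 1 -> norm1 (f' (z + (t%:C)%C * v) - A) <= K) ->
  norm1 (f (z + v) - f z - A * v) <= 2 * K * norm1 v.
Proof.
move=> df H.
pose phi (t : R) := f (z + (t%:C)%C * v) - A * ((t%:C)%C * v).
pose dphi (t : R) := (f' (z + (t%:C)%C * v) - A) * v.
have dP (t e : R) : 0 <= t <= 1 -> 0 < e -> exists2 d : R, 0 < d &
    forall h, `|h| < d -> norm1 (phi (t + h) - phi t - dphi t * (h%:C)%C) <= e * `|h|.
  move=> t01 e0; pose N := norm1 v + 1.
  have N0 : 0 < N by rewrite ltr_wpDl ?norm1_ge0.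
  have [d d0 Hd] := df t t01 (e / N) (divr_gt0 e0 N0).
  exists (d / N) => [|h]; first by rewrite divr_gt0.
  rewrite ltr_pdivlMr // => hd.
  have hv : norm1 ((h%:C)%C * v) <= `|h| * N.
    by rewrite norm1_realM ler_wpM2l // lerDl.
  have -> : phi (t + h) - phi t - dphi t * (h%:C)%C =
      f (z + (t%:C)%C * v + (h%:C)%C * v) - f (z + (t%:C)%C * v)
       - f' (z + (t%:C)%C * v) * ((h%:C)%C * v).
    by rewrite /phi /dphi rmorphD /= mulrDl addrA; ring.
  apply: (le_trans (Hd _ (le_lt_trans hv hd))).
  have -> : e * `|h| = e / N * (`|h| * N) by field; rewrite gt_eqF.
  by rewrite ler_wpM2l // divr_ge0 // ltW.
have nd t : 0 <= t <= 1 -> norm1 (dphi t) <= K * norm1 v.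
  move=> t01; apply: (le_trans (norm1M _ _)).
  by rewrite ler_wpM2r ?norm1_ge0 // H.
have part (p : R[i] -> R) : (forall w, `|p w| <= norm1 w) ->
    (forall a b, p (a + b) = p a + p b) -> (forall a, p (- a) = - p a) ->
    (forall a (x : R), p (a * (x%:C)%C) = p a * x) ->
    `|p (phi 1 - phi 0)| <= K * norm1 v.
  move=> pn pD pN pZ.
  have der t : 0 <= t <= 1 -> is_derive (t : R) 1 (fun x => p (phi x)) (p (dphi t)).
    move=> t01; apply/rdiffP => e e0; have [d d0 Hd] := dP t e t01 e0.
    exists d => // h /Hd; apply: le_trans; apply: le_trans (pn _).
    have pE a b c : p (a - b - c) = p a - p b - p c by rewrite !pD !pN.
    by rewrite (pE (phi _) (phi _)) (pZ (dphi t)).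
  have [||c c01] := @MVT_segment _ (fun x => p (phi x)) (fun t => p (dphi t)) 0 1 ler01.
  - by move=> x; rewrite in_itv /= => /andP[/ltW x0 /ltW x1]; apply: der; rewrite x0.
  - apply: continuous_in_subspaceT => x /set_mem /=; rewrite in_itv /= => x01.
    by apply/differentiable_continuous/derivable1_diffP; case: (der x x01).
  rewrite -pN -pD subr0 mulr1 => ->.
  by apply: (le_trans (pn _)); apply: nd; move: c01; rewrite in_itv.
have -> : f (z + v) - f z - A * v = phi 1 - phi 0.
  by rewrite /phi rmorph0 rmorph1 !mul0r mul1r mulr0 addr0 subr0 addrAC.
have pZ1 (a : R[i]) (x : R) : Re (a * (x%:C)%C) = Re a * x by rewrite ReM /= mulr0 subr0.
have pZ2 (a : R[i]) (x : R) : Im (a * (x%:C)%C) = Im a * x by rewrite ImM /= mulr0 add0r.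
have := part _ Re_le_norm1 ReD ReN pZ1; have := part _ Im_le_norm1 ImD ImN pZ2.
rewrite /norm1; lra.
Qed.

Lemma expR_onto (r : R) : 0 < r -> exists S, expR S = r.
Proof. by move=> r0; exists (ln r); rewrite lnK. Qed.

Lemma ccont_circle_kernel f z (S t : R) (L : R[i]) :
  cdiff f (z + cexp (S +i* t)%C) L -> ccont (fun t => circle_kernel f z (S +i* t)%C) t.
Proof. by move=> /cdiff_circle_kernel[L' /cdiff_vcont]. Qed.

Lemma twopi_gt0 : 0 < (pi *+ 2 : R). Proof. by rewrite mulrn_wgt0 // pi_gt0. Qed.

(** Cauchy's estimate on the circle of radius [r / 4], whose points have [norm1] at most [r / 2].
    The constant 16 is 4 from the radius, 2 from [norm1_cexp] and 2 from [cint_bound]. *)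
Lemma derivative_bound f f' z (r M : R) : 0 < r ->
  (forall v, norm1 v < r -> cdiff f (z + v) (f' (z + v))) ->
  (forall v, norm1 v < r -> norm1 (f (z + v)) <= M) -> norm1 (f' z) <= 16 * M / r.
Proof.
move=> r0 df bf; have [S ES] := expR_onto (r / 4) (divr_gt0 r0 (ltr0Sn _ 3)).
have dz : cdiff f z (f' z) by have := df 0; rewrite addr0 norm1_0; exact.
have r2 v : norm1 v <= 2 * expR S -> norm1 v < r by rewrite ES; lra.
have nE (t : R) : norm1 (cexp (S +i* t)%C) <= 2 * expR S := norm1_cexp _.
have := cauchy_derivative f z S (f' z) _ dz => CD.
have {}CD := CD (fun v vr => ex_intro _ _ (df v (r2 v vr))).
have M0 : 0 <= M by apply: le_trans (bf 0 _); rewrite ?norm1_ge0 ?norm1_0.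
have : norm1 (cint (fun t => circle_kernel f z (S +i* t)%C) 0 (pi *+ 2)) <=
    2 * (M * (2 / expR S)) * (pi *+ 2 - 0).
  apply: cint_bound; first exact/ltW/twopi_gt0.
    by move=> t _; apply: ccont_circle_kernel; apply: df; exact/r2/nE.
  move=> t _; apply: (le_trans (norm1M _ _)).
  rewrite ler_pM ?norm1_ge0 //; first exact/bf/r2/nE.
  by have := norm1_cexp (- (S +i* t)%C); rewrite /= expRN.
rewrite CD norm1_realM gtr0_norm ?twopi_gt0 // subr0 mulrC ler_pM2r ?twopi_gt0 //.
by rewrite ES => /le_trans; apply; rewrite le_eqVlt; apply/orP; left; apply/eqP; field; rewrite gt_eqF.
Qed.

(** Convexity of the ball, which keeps the segments of [cdiff_segment] inside it. *)
Lemma norm1_segment (a b : R[i]) (t r : R) : 0 <= t <= 1 ->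
  norm1 a < r -> norm1 (a + b) < r -> norm1 (a + (t%:C)%C * b) < r.
Proof.
move=> t01 ar br.
have -> : a + (t%:C)%C * b = ((1 - t)%:C)%C * a + (t%:C)%C * (a + b).
  by rewrite rmorphB rmorph1 /=; ring.
apply: (le_lt_trans (norm1D _ _)); rewrite !norm1_realM !ger0_norm; [|lra..].
apply: (@le_lt_trans _ _ (Num.max (norm1 a) (norm1 (a + b)))); last by rewrite gt_max ar.
set m := Num.max _ _.
have am : norm1 a <= m by rewrite le_max lexx.
have bm : norm1 (a + b) <= m by rewrite le_max lexx orbT.
have : (1 - t) * norm1 a <= (1 - t) * m by rewrite ler_wpM2l //; lra.
have : t * norm1 (a + b) <= t * m by rewrite ler_wpM2l //; lra.
lra.
Qed.

Theorem cdiff_derivative f f' (z : R[i]) (r0 : R) : 0 < r0 ->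
  (forall v, norm1 v < r0 -> cdiff f (z + v) (f' (z + v))) ->
  exists L, cdiff f' z L.
Proof.
move=> r00 df0.
(* Differentiability at [z] alone bounds [f] nearby; the cap 1 on the radius controls both the
   linear term and the error. *)
have [r [M [rpos df bf]]] : exists r M, [/\ 0 < r,
    forall v, norm1 v < r -> cdiff f (z + v) (f' (z + v)) &
    forall v, norm1 v < r -> norm1 (f (z + v)) <= M].
  have dz : cdiff f z (f' z) by have := df0 0; rewrite addr0 norm1_0; exact.
  have [d d0 H] := dz 1 ltr01.
  exists (Num.min (Num.min r0 d) 1), (norm1 (f z) + norm1 (f' z) + 1); split.
  - by rewrite !lt_min r00 d0 ltr01.
  - by move=> v; rewrite !lt_min => /andP[/andP[vr _] _]; exact: df0.
  move=> v; rewrite !lt_min => /andP[/andP[_ vd] v1]; have {}H := H v vd.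
  have -> : f (z + v) = (f (z + v) - f z - f' z * v) + (f z + f' z * v) by ring.
  have := norm1D (f (z + v) - f z - f' z * v) (f z + f' z * v).
  have := norm1D (f z) (f' z * v); have := norm1M (f' z) v.
  have : norm1 (f' z) * norm1 v <= norm1 (f' z) * 1 by rewrite ler_wpM2l ?norm1_ge0 // ltW.
  lra.
pose C1 := 16 * M / (r / 2).
have B1 v : norm1 v < r / 2 -> norm1 (f' (z + v)) <= C1.
  move=> vr; have sub w : norm1 w < r / 2 -> norm1 (v + w) < r.
    by move=> wr; apply: (le_lt_trans (norm1D _ _)); lra.
  apply: (@derivative_bound f f'); first lra.
    by move=> w /sub wr; rewrite -addrA; exact: df.
  by move=> w /sub wr; rewrite -addrA; exact: bf.
have C10 : 0 <= C1 by apply: le_trans (B1 0 _); rewrite ?norm1_ge0 // norm1_0; lra.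
clearbody C1.
have L1 v h : norm1 v < r / 2 -> norm1 (v + h) < r / 2 ->
    norm1 (f (z + v + h) - f (z + v)) <= 2 * C1 * norm1 h.
  move=> vr hr; have := @cdiff_segment f f' (z + v) h 0 C1; rewrite mul0r subr0; apply.
    move=> t t01; rewrite -addrA; apply: df.
    by have := norm1_segment _ _ _ _ t01 vr hr; lra.
  by move=> t t01; rewrite subr0 -addrA; apply: B1; exact: norm1_segment.
(* Cauchy's estimate applied to [x -> f (x + h) - f x], which is at most [2 * C1 * norm1 h], on
   balls of radius [r / 4]. *)
pose C2 := 16 * (2 * C1) / (r / 4).
have C20 : 0 <= C2 by rewrite /C2 divr_ge0 ?mulr_ge0 //; lra.
have L2 v h : norm1 v < r / 4 -> norm1 (v + h) < r / 4 ->
    norm1 (f' (z + v + h) - f' (z + v)) <= C2 * norm1 h.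
  move=> vr hr.
  have -> : C2 * norm1 h = 16 * (2 * C1 * norm1 h) / (r / 4) by rewrite /C2; ring.
  apply: (@derivative_bound (fun x => f (x + h) - f x) (fun x => f' (x + h) - f' x)).
  - by lra.
  - move=> u ur; apply/cdiffP; apply: is_deriveB.
      have : is_derive (z + v + u : R[i]^o) 1 (fun x : R[i]^o => x + h) 1.
        by apply: is_derive_eq; rewrite addr0.
      move=> dsh; rewrite -[f' _]mulr1; apply: (@is_derive1_compN (R[i]) (+%R^~ h) f) dsh _.
      apply/cdiffP; have -> : z + v + u + h = z + (v + u + h) by ring.
      apply: df; rewrite addrAC; have := norm1D (v + h) u; lra.
    apply/cdiffP; rewrite -addrA; apply: df; have := norm1D v u; lra.
  - move=> u ur; have -> : z + v + u + h = z + (v + u) + h by ring.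
    rewrite -[z + v + u]addrA; apply: L1; first by have := norm1D v u; lra.
    by rewrite addrAC; have := norm1D (v + h) u; lra.
clearbody C2.
have L3 v h : norm1 v < r / 4 -> norm1 (v + h) < r / 4 ->
    norm1 (f (z + v + h) - f (z + v) - f' (z + v) * h) <= 2 * (C2 * norm1 h) * norm1 h.
  move=> vr hr; apply: (@cdiff_segment f f').
    move=> t t01; rewrite -addrA; apply: df.
    by have := norm1_segment _ _ _ _ t01 vr hr; lra.
  move=> t t01; apply: (le_trans (L2 _ _ vr _)); first exact: norm1_segment.
  rewrite norm1_realM ler_wpM2l // ger0_norm; last by lra.
  by have := norm1_ge0 h; nra.
(* Circle points have [norm1] at most [r / 16], so adding an [h] below [r / 8] stays within the
   radius [r / 4] required by [L3]. *)
have [S ES] := expR_onto (r / 32) (divr_gt0 rpos (ltr0Sn _ 31)).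
have r8 v : norm1 v <= 2 * expR S -> norm1 v < r / 8 by rewrite ES; lra.
have E8 (t : R) : norm1 (cexp (S +i* t)%C) < r / 8 by exact/r8/norm1_cexp.
have CD h : norm1 h < r / 8 -> cint (fun t => circle_kernel f (z + h) (S +i* t)%C) 0 (pi *+ 2)
    = ((pi *+ 2)%:C)%C * f' (z + h).
  move=> hr; apply: cauchy_derivative; last by apply: df; lra.
  move=> v /r8 vr; exists (f' (z + (h + v))); rewrite -addrA; apply: df.
  by have := norm1D h v; lra.
have cK h : norm1 h < r / 8 -> ccont_on (fun t => circle_kernel f (z + h) (S +i* t)%C) 0 (pi *+ 2).
  move=> hr t _; apply: (@ccont_circle_kernel _ _ _ _ (f' (z + (h + cexp (S +i* t)%C)))).
  rewrite -addrA; apply: df; have := E8 t; have := norm1D h (cexp (S +i* t)%C); lra.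
(* The differentiability of [f'] being the goal, its continuity is taken from the Lipschitz bound
   [L2]. *)
have cK' : ccont_on (fun t => circle_kernel f' z (S +i* t)%C) 0 (pi *+ 2).
  move=> t _; apply: ccontM; last first.
    apply: (@cdiff_vcont _ (fun u => cexp (- u)) _ _ (cexp (- (S +i* t)%C) * (-1))).
    have /cdiffP dN := cdiff_cexp (- (S +i* t)%C).
    by apply/cdiffP; apply: (@is_derive1_compN (R[i]) -%R cexp) dN.
  move=> e e0.
  have [|d d0 H] := cdiff_vcont _ _ _ _ (cdiff_cexp (S +i* t)%C) (e / (C2 + 1)).
    by rewrite divr_gt0 //; lra.
  exists d => // y /H {}H.
  have -> : z + cexp (S +i* y)%C = z + cexp (S +i* t)%C + (cexp (S +i* y)%C - cexp (S +i* t)%C) by ring.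
  apply: (le_trans (L2 _ _ _ _)).
  - by have := E8 t; lra.
  - by rewrite addrC subrK; have := E8 y; lra.
  apply: (@le_trans _ _ ((C2 + 1) * (e / (C2 + 1)))).
    by rewrite ler_pM ?norm1_ge0 // lerDl.
  by rewrite mulrC divfK // gt_eqF // ltr_wpDl.
(* The formula for [f' (z + h)], formally differentiated in [h] under the integral at [h = 0]. *)
pose L := ((pi *+ 2)%:C)%C^-1 * cint (fun t => circle_kernel f' z (S +i* t)%C) 0 (pi *+ 2).
have pi0 : ((pi *+ 2)%:C)%C != 0 :> R[i].
  by rewrite -(rmorph0 (real_complex R)) (inj_eq (@complexI R)) gt_eqF // twopi_gt0.
pose C3 := 8 * C2 / expR S.
have C30 : 0 <= C3 by rewrite /C3 divr_ge0 ?mulr_ge0 // expR_ge0.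
exists L => e e0; exists (Num.min (r / 8) (e / (C3 + 1))).
  by rewrite lt_min !divr_gt0 //; lra.
move=> h; rewrite lt_min => /andP[hr he].
(* Its integral is [2 pi] times [f' (z + h) - f' z - L h], and [L3] makes it quadratic in [h].
   Writing [z + 0] lets [CD] and [cK] apply with [h = 0]. *)
pose q t := circle_kernel f (z + h) (S +i* t)%C + ((-1) * circle_kernel f (z + 0) (S +i* t)%C
   + (- h) * circle_kernel f' z (S +i* t)%C).
have n0 : norm1 (0 : R[i]) < r / 8 by rewrite norm1_0; lra.
have cc (c : R[i]) : ccont_on (fun=> c) 0 (pi *+ 2) by move=> t _; exact: ccont_cst.
have cq2 : ccont_on (fun t => (-1) * circle_kernel f (z + 0) (S +i* t)%C
   + (- h) * circle_kernel f' z (S +i* t)%C) 0 (pi *+ 2).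
  by apply: ccont_onD; apply: ccont_onM => //; exact: cK.
have cq : ccont_on q 0 (pi *+ 2) by apply: ccont_onD => //; exact: cK.
have Eq : cint q 0 (pi *+ 2) = ((pi *+ 2)%:C)%C * (f' (z + h) - f' z - L * h).
  rewrite cintD //; last exact: cK.
  rewrite cintD; [|by apply: ccont_onM => //; exact: cK..].
  rewrite !cintZ //; last exact: cK.
  rewrite !CD // addr0 /L; move: pi0.
  by move: ((pi *+ 2)%:C)%C (cint _ _ _) => P X P0; field.
have : norm1 (cint q 0 (pi *+ 2)) <= 2 * (2 * (C2 * norm1 h) * norm1 h * (2 / expR S)) * (pi *+ 2 - 0).
  apply: cint_bound => //; first exact/ltW/twopi_gt0.
  move=> t _; set u := (S +i* t)%C.
  have -> : q t = (f (z + cexp u + h) - f (z + cexp u) - f' (z + cexp u) * h) * cexp (- u).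
    by rewrite /q /circle_kernel addr0 -/u [z + h + _]addrAC; ring.
  apply: (le_trans (norm1M _ _)); rewrite ler_pM ?norm1_ge0 //.
    apply: L3; first by have := E8 t; rewrite -/u; lra.
    by have := norm1D (cexp u) h; have := E8 t; rewrite -/u; lra.
  by have := norm1_cexp (- u); rewrite /= expRN.
rewrite Eq norm1_realM gtr0_norm ?twopi_gt0 // subr0 mulrC ler_pM2r ?twopi_gt0 //.
move=> /le_trans; apply.
have -> : 2 * (2 * (C2 * norm1 h) * norm1 h * (2 / expR S)) = C3 * norm1 h * norm1 h.
  by rewrite /C3; ring.
rewrite ler_wpM2r ?norm1_ge0 //.
move: he; rewrite ltr_pdivlMr; last by lra.
by have := norm1_ge0 h; nra.
Qed.

End SecondDerivative.

(** * Bell polynomials *)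

Section BellGenerating.
Context {F : numFieldType}.
Implicit Types (z : nat -> F) (i n N K : nat).

Let fct n : F := n`!%:R.

Let fct_neq0 n : fct n != 0. Proof. by rewrite pnatr_eq0 -lt0n fact_gt0. Qed.

(** The series [exp (c Y)] cut off at [Y^K]; the outer variable [Y] counts the number of blocks, the
    inner one their total size. *)
Definition texp K (c : {poly F}) : {poly {poly F}} :=
  \poly_(j < K) ((fct j)^-1 *: c ^+ j).

(** The law [exp (c Y) exp (d Y) = exp ((c + d) Y)] holds in degrees below the cut-off. *)
Lemma coef_prod_texp K (I : Type) (r : seq I) (c : I -> {poly F}) n : (n < K)%N ->
  (\prod_(m <- r) texp K (c m))`_n = (fct n)^-1 *: (\sum_(m <- r) c m) ^+ n.
Proof.
elim: r n => [|m r IH] n nK.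
  rewrite !big_nil coef1 expr0n; case: n nK => [|n] _ /=; last by rewrite scaler0.
  by rewrite /fct invr1 scale1r.
rewrite !big_cons coefM addrC exprDn scaler_sumr; apply: eq_bigr => j _.
have jn : (j <= n)%N by rewrite -ltnS.
have jK : (j < K)%N by exact: leq_ltn_trans nK.
rewrite coef_poly jK IH; last by rewrite (leq_ltn_trans _ nK) // leq_subr.
rewrite -scalerAl -scalerAr scalerA [_ ^+ (n - j) * _]mulrC -scaler_nat scalerA; congr (_ *: _).
have := bin_fact jn => /(congr1 (fun x => x%:R : F)); rewrite !natrM -!/(fct _) => <-.
have b0 : 'C(n, j)%:R != 0 :> F by rewrite pnatr_eq0 -lt0n bin_gt0.
by field; rewrite b0 !fct_neq0.
Qed.

(* Multinomial theorem, read off the product of truncated exponentials. *)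
Lemma multinomial_sum K N (c : 'I_N -> {poly F}) n : (n < K)%N ->
  \sum_(J : {ffun 'I_N -> 'I_K} | (\sum_(m < N) (J m : nat) == n)%N)
    \prod_(m < N) ((fct (J m))^-1 *: c m ^+ J m) = (fct n)^-1 *: (\sum_(m < N) c m) ^+ n.
Proof.
move=> nK; rewrite -(coef_prod_texp _ _ _ _ n nK) /texp.
under eq_bigr do rewrite poly_def.
rewrite bigA_distr_bigA coef_sum [RHS](bigID (fun J : {ffun 'I_N -> 'I_K} =>
  (\sum_(m < N) (J m : nat) == n)%N)) /= [X in _ + X]big1 ?addr0; last first.
  move=> J nJ; under eq_bigr do rewrite -mul_polyC.
  by rewrite big_split /= -rmorph_prod mul_polyC prodrXr coefZ coefXn eq_sym (negbTE nJ) mulr0.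
apply: eq_bigr => J /eqP EJ; under [in RHS]eq_bigr do rewrite -mul_polyC.
by rewrite big_split /= -rmorph_prod mul_polyC prodrXr coefZ coefXn EJ eqxx mulr1.
Qed.

(** The truncated series [z_1 x + z_2 x^2 / 2! + ...]. The factor ['X] is kept apart so that [x^n]
    comes out of the [n]-th power. *)
Definition bellP N z : {poly F} := 'X * \poly_(m < N) (z m.+1 / fct m.+1).

Lemma bellP_sum N z : bellP N z = \sum_(m < N) (z m.+1 / fct m.+1) *: 'X^(m.+1).
Proof.
rewrite /bellP poly_def mulr_sumr; apply: eq_bigr => m _.
by rewrite -scalerAr -exprS.
Qed.

Lemma coef_bellP N z i : (bellP N z)`_i = if (0 < i <= N)%N then z i / fct i else 0.
Proof. by rewrite /bellP coefXM; case: i => //= i; rewrite coef_poly. Qed.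

Lemma coef_expr_eq (p q : {poly F}) d n : (forall j, (j <= d)%N -> p`_j = q`_j) ->
  forall j, (j <= d)%N -> (p ^+ n)`_j = (q ^+ n)`_j.
Proof.
move=> pq; elim: n => [|n IH] j jd; first by rewrite !expr0.
rewrite !exprS !coefM; apply: eq_bigr => i _; have ij : (i <= j)%N by rewrite -ltnS.
by rewrite pq ?IH //; [exact: leq_trans (leq_subr _ _) jd|exact: leq_trans ij jd].
Qed.

(** After removing [x^n], the coefficient of degree [i - n] sees only the first [i - n + 1]
    terms. *)
Lemma bellP_trunc N i n z : (i - n < N)%N ->
  (bellP N z ^+ n)`_i = (bellP (i - n).+1 z ^+ n)`_i.
Proof.
move=> iN; rewrite /bellP !exprMn !coefXnM; case: ltnP => // ni.
apply: (@coef_expr_eq _ _ (i - n)) => // j jn.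
by rewrite !coef_poly ltnS jn (leq_ltn_trans jn iN).
Qed.

(** The generating function [P^n / n!] of the [n]-th column. Leaving [N] free lets polynomials with
    different indices share one [P], which differentiation requires. *)
Lemma bellE N i n z : (i - n < N)%N -> bell i n z = fct i / fct n * (bellP N z ^+ n)`_i.
Proof.
move=> iN; rewrite (bellP_trunc _ _ _ _ iN) bellP_sum.
(* If [i < n], then [i - n] is 0 and a single index remains, whose multiplicity would equal both [i]
   and [n]; both sides vanish. *)
have [ni|ni] := leqP n i; last first.
  have E : (i - n)%N = 0%N by apply/eqP; rewrite subn_eq0 ltnW.
  rewrite /bell E big1 => [|J /andP[]].
    by rewrite big_ord1 exprZn -exprM mul1n coefZ coefXn ltn_eqF // mulr0 mulr0.
  by rewrite !big_ord1 mul1n => /eqP H1 /eqP H2; rewrite -H1 -H2 ltnn in ni.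
rewrite -mulrA -coefZ -(@multinomial_sum i.+1) ?ltnS // coef_sum mulr_sumr /bell.
under eq_bigl do rewrite andbC; rewrite big_mkcondr /=.
apply: eq_bigr => J _.
have -> : \prod_(m < (i - n).+1) ((fct (J m))^-1 *: ((z m.+1 / fct m.+1) *: 'X^(m.+1)) ^+ J m) =
   (\prod_(m < (i - n).+1) ((fct (J m))^-1 * (z m.+1 / fct m.+1) ^+ J m)) *:
     'X^(\sum_(m < (i - n).+1) (m.+1 * J m)).
  rewrite -prodrXr -scaler_prod; apply: eq_bigr => m _.
  by rewrite exprZn scalerA -exprM.
rewrite coefZ coefXn eq_sym; case: eqP => _; last by rewrite !mulr0.
rewrite mulr1 big_split /= mulrA; congr (_ * _ * _).
by rewrite natr_prod prodfV.
Qed.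

End BellGenerating.

(** * Derivatives of Bell polynomials along a function *)

Section Derivatives.
Context {K : numFieldType}.
Implicit Types (f g : K -> K) (z : K).

Let fact1 : 1`! = 1%N. Proof. by []. Qed.
Let fact2 : 2`! = 2%N. Proof. by []. Qed.

Lemma is_derive_sumf n (f_ : 'I_n -> K -> K) z (df : 'I_n -> K) :
  (forall i, is_derive z 1 (f_ i) (df i)) ->
  is_derive z 1 (fun w => \sum_(i < n) f_ i w) (\sum_(i < n) df i).
Proof.
move=> H; have := is_derive_sum H; congr (is_derive _ _ _ _).
by apply/funext => w; rewrite fct_sumE.
Qed.

Lemma is_deriveMf f g z (df dg : K) : is_derive z 1 f df -> is_derive z 1 g dg ->
  is_derive z 1 (fun w => f w * g w) (df * g z + f z * dg).
Proof.
move=> Df Dg; have := is_deriveM Df Dg; congr is_derive.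
by rewrite /GRing.scale /= addrC [g z * _]mulrC.
Qed.

Lemma is_deriveZf f z (c df : K) : is_derive z 1 f df ->
  is_derive z 1 (fun w => c * f w) (c * df).
Proof.
move=> Df; have := is_deriveMf _ _ _ _ _ (is_derive_cst c z 1) Df.
by rewrite mul0r add0r.
Qed.

Lemma is_deriveXf f z (df : K) n : is_derive z 1 f df ->
  is_derive z 1 (fun w => f w ^+ n) (n%:R * f z ^+ n.-1 * df).
Proof.
move=> Df; case: n => [|n]; last by have := is_deriveX n.+1 Df; rewrite -exprfctE.
by rewrite !mul0r; exact: is_derive_cst.
Qed.

Lemma bell0 i (c : nat -> K) : bell i 0 c = (i == 0%N)%:R.
Proof.
rewrite (@bellE _ i.+1) ?subn0 // expr0 coef1 fact0 divr1.
by case: i => [|i]; rewrite ?mulr0 ?mulr1.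
Qed.

Section Bell.
Variables (T_ : nat -> K -> K) (z : K).
Hypothesis dT : forall n, is_derive z 1 (T_ n) (T_ n.+1 z).

Local Notation P N w := (bellP N (fun m => T_ m w)).

(** For [P = sum T_m x^m / m!], differentiating in [w] shifts the index [m], as differentiating in
    [x] does, except for the lost constant: the result is [P' - T_1]. Powers follow by the product
    rule; [i < N] stays clear of the truncation. *)
Lemma is_derive_bellP N l i : (i < N)%N ->
  is_derive z 1 (fun w => (P N w ^+ l)`_i)
    ((deriv (P N z ^+ l) - (l%:R * T_ 1%N z) *: P N z ^+ l.-1)`_i).
Proof.
have d1 j : (j < N)%N -> is_derive z 1 (fun w => (P N w)`_j) ((deriv (P N z) - (T_ 1%N z)%:P)`_j).
  move=> jN; rewrite coefB coef_deriv coefC coef_bellP jN /=.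
  case: j jN => [|j] jN.
    rewrite eqxx fact1 invr1 mulr1 subrr.
    under eq_fun do rewrite coef_bellP; exact: is_derive_cst.
  rewrite /= subr0 (_ : _ *+ _ = (j.+1`!%:R)^-1 * T_ j.+2 z); last first.
    rewrite factS natrM -mulr_natr.
    have a0 : j.+2%:R != 0 :> K by rewrite pnatr_eq0.
    have b0 : j.+1`!%:R != 0 :> K by rewrite pnatr_eq0 -lt0n fact_gt0.
    by move: (j.+2%:R) (j.+1`!%:R) a0 b0 => x y x0 y0; field; rewrite x0 y0.
  under eq_fun do rewrite coef_bellP (ltnW jN) /= mulrC; exact: is_deriveZf.
elim: l i => [|l IH] i iN.
  rewrite expr0 derivC mul0r scale0r subr0 coef0.
  under eq_fun do rewrite expr0; exact: is_derive_cst.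
have : is_derive z 1 (fun w => \sum_(j < i.+1) (P N w ^+ l)`_j * (P N w)`_(i - j))
   (\sum_(j < i.+1) ((deriv (P N z ^+ l) - (l%:R * T_ 1%N z) *: P N z ^+ l.-1)`_j * (P N z)`_(i - j)
     + (P N z ^+ l)`_j * (deriv (P N z) - (T_ 1%N z)%:P)`_(i - j))).
  apply: is_derive_sumf => j.
  have ji : (j <= i)%N by rewrite -ltnS.
  apply: is_deriveMf; first exact/IH/(leq_ltn_trans ji iN).
  exact/d1/(leq_ltn_trans (leq_subr _ _) iN).
congr (is_derive _ _ _ _); first by apply/funext => w; rewrite exprSr coefM.
rewrite big_split /= -!coefM -coefD; congr (nth _ (polyseq _) _).
rewrite exprSr derivM mulrBl mulrBr -scalerAl.
have -> : (l%:R * T_ 1%N z) *: (P N z ^+ l.-1 * P N z) = (l%:R * T_ 1%N z) *: P N z ^+ l.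
  by case: (l) => [|l']; rewrite ?mul0r ?scale0r //= exprSr.
rewrite [_ * (_)%:P]mulrC mul_polyC -natr1 [(_ + 1) * _]mulrDl mul1r scalerDl opprD.
by rewrite addrACA.
Qed.

Lemma is_derive_bell0 i : is_derive z 1 (fun w => bell i 0 (fun m => T_ m w)) (bell i.+1 0 (fun m => T_ m z)).
Proof.
rewrite bell0; under eq_fun do rewrite bell0; exact: is_derive_cst.
Qed.

(** The recurrence [B_(i+1,l+1) = T' B_(i,l) + (B_(i,l+1))'], read off the coefficients of
    [is_derive_bellP]. *)
Lemma is_derive_bellS i l : is_derive z 1 (fun w => bell i l.+1 (fun m => T_ m w))
  (bell i.+1 l.+1 (fun m => T_ m z) - T_ 1%N z * bell i l (fun m => T_ m z)).
Proof.
have E a b w : (a <= i.+1)%N -> bell a b (fun m => T_ m w) =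
    a`!%:R / b`!%:R * (P i.+2 w ^+ b)`_a.
  by move=> ai; apply: bellE; rewrite ltnS (leq_trans (leq_subr _ _)).
rewrite !E // (_ : _ - _ = i`!%:R / l.+1`!%:R * (deriv (P i.+2 z ^+ l.+1)
   - (l.+1%:R * T_ 1%N z) *: P i.+2 z ^+ l)`_i).
  under eq_fun do rewrite E //.
  by apply: is_deriveZf; apply: (is_derive_bellP _ l.+1); rewrite ltnW.
rewrite coefB coef_deriv coefZ -[_ *+ i.+1]mulr_natr !factS !natrM.
have a0 : l.+1%:R != 0 :> K by rewrite pnatr_eq0.
have b0 : l`!%:R != 0 :> K by rewrite pnatr_eq0 -lt0n fact_gt0.
by move: (i.+1%:R) (i`!%:R) (l.+1%:R) (l`!%:R) a0 b0 => x y u v u0 v0; field; rewrite u0 v0.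
Qed.

End Bell.

Lemma bell_gt (i n : nat) (c : nat -> K) : (i < n)%N -> bell i n c = 0.
Proof.
move=> ni; rewrite (@bellE _ (i - n).+1) // /bellP exprMn coefXnM ni mulr0 //.
Qed.

Lemma bell_diag n (c : nat -> K) : bell n n c = c 1%N ^+ n.
Proof.
rewrite (@bellE _ 1) ?subnn // divff ?mul1r; last by rewrite pnatr_eq0 -lt0n fact_gt0.
rewrite /bellP exprMn coefXnM ltnn subnn.
rewrite poly_def big_ord1 expr0 alg_polyC -rmorphXn coefC eqxx.
by rewrite fact1 divr1.
Qed.

(** Exactly one of the [n] factors of [P^n] contributes its quadratic term. This is the source of
    [T''] in [M_(k,k-1)]. *)
Lemma bell_subdiag n (c : nat -> K) :
  bell n.+1 n c = 'C(n.+1, 2)%:R * c 1%N ^+ n.-1 * c 2%N.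
Proof.
rewrite (@bellE _ 2) ?subSn ?leqnn ?subnn // /bellP exprMn coefXnM ltnNge leqnSn /= subSnn.
have -> : \poly_(m < 2) (c m.+1 / (m.+1)`!%:R) = (c 1%N)%:P + (c 2%N / 2) *: 'X.
  rewrite poly_def !big_ord_recl big_ord0 /= addr0 expr0 alg_polyC expr1 fact1 fact2 divr1.
  by [].
have n0 : n`!%:R != 0 :> K by rewrite pnatr_eq0 -lt0n fact_gt0.
rewrite factS natrM mulfK //.
have -> : (((c 1%N)%:P + (c 2%N / 2) *: 'X) ^+ n)`_1 = n%:R * c 1%N ^+ n.-1 * (c 2%N / 2).
  case: n {n0} => [|n]; first by rewrite expr0 coef1 !mul0r.
  rewrite exprDn coef_sum !big_ord_recl /= big1 ?addr0.
    rewrite !subn0 bin0 bin1 expr0 mulr1 mulr1n -rmorphXn coefC /= add0r.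
    rewrite /bump /= subn1 /= expr1 -scalerAr coefMn coefZ -rmorphXn coefCM coefX eqxx mulr1.
    by rewrite -mulr_natr; ring.
  move=> i _; rewrite /bump /= !add1n exprZn -scalerAr coefMn coefZ -rmorphXn coefCM coefXn.
  by rewrite /= !mulr0 mul0rn.
have -> : 'C(n.+1, 2)%:R = n.+1%:R * n%:R / 2 :> K.
  have := bin_ffact n.+1 2; rewrite fact2 ffactnS ffactn1 => /(congr1 (fun x => x%:R : K)); rewrite !natrM => <-.
  by rewrite mulfK // pnatr_eq0.
by field.
Qed.

End Derivatives.

(** * Leibniz, Faa di Bruno and triangular systems *)

Section HigherDerivatives.
Context {K : numFieldType}.
Implicit Types (f g : K -> K) (z : K) (D : set K).

(** Reduces a closed formula for all derivatives to a single differentiation of the candidate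
    [g_ n]; openness of [D] makes the equality hold near each point. *)
Lemma derive1n_eq D f (g_ : nat -> K -> K) : open D ->
  (forall z, D z -> f z = g_ 0%N z) ->
  (forall n z, D z -> is_derive z 1 (g_ n) (g_ n.+1 z)) ->
  forall n z, D z -> derive1n n f z = g_ n z.
Proof.
move=> oD f0 dg; elim=> [|n IH] z Dz; first by rewrite derive1n0 f0.
rewrite derive1nS derive1E; have [_ <-] := dg n z Dz.
by apply: near_eq_derive; apply: filterS (open_nbhs_nbhs (conj oD Dz)) => w /IH.
Qed.

(** Pascal's rule. Stated for sequences, so that [u_] can be the Faa di Bruno sums. *)
Lemma is_derive_leibniz (u_ h_ : nat -> K -> K) z n :
  (forall m, is_derive z 1 (u_ m) (u_ m.+1 z)) ->
  (forall m, is_derive z 1 (h_ m) (h_ m.+1 z)) ->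
  is_derive z 1 (fun w => \sum_(i < n.+1) 'C(n, i)%:R * u_ i w * h_ (n - i)%N w)
    (\sum_(i < n.+2) 'C(n.+1, i)%:R * u_ i z * h_ (n.+1 - i)%N z).
Proof.
move=> du dh.
have : is_derive z 1 (fun w => \sum_(i < n.+1) 'C(n, i)%:R * u_ i w * h_ (n - i)%N w)
   (\sum_(i < n.+1) ('C(n, i)%:R * u_ i.+1 z * h_ (n - i)%N z +
       'C(n, i)%:R * u_ i z * h_ (n - i).+1 z)).
  by apply: is_derive_sumf => i; apply: is_deriveMf => //; exact: is_deriveZf.
congr is_derive; rewrite big_split /= [RHS]big_ord_recl /= bin0 subn0.
have -> : \sum_(i < n.+1) 'C(n.+1, bump 0 i)%:R * u_ (bump 0 i) z * h_ (n.+1 - bump 0 i)%N z =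
  \sum_(i < n.+1) 'C(n, i)%:R * u_ i.+1 z * h_ (n - i)%N z +
  \sum_(i < n.+1) 'C(n, i.+1)%:R * u_ i.+1 z * h_ (n - i)%N z.
  rewrite -big_split /=; apply: eq_bigr => i _.
  by rewrite /bump /= add1n subSS binS natrD !mulrDl addrC.
rewrite addrCA; congr (_ + _).
rewrite [LHS]big_ord_recl /= bin0 subn0; congr (_ + _).
rewrite [RHS]big_ord_recr /= bin_small // !mul0r addr0.
by apply: eq_bigr => i _; rewrite /bump /= add1n subnSK.
Qed.

(** The terms [- T' B_(i,l-1)] in the derivatives of the Bell polynomials cancel the chain-rule
    terms with [l < i]; the one with [l = i] is the new diagonal term. *)
Lemma is_derive_faadibruno (T_ F_ : nat -> K -> K) z i :
  (forall m, is_derive z 1 (T_ m) (T_ m.+1 z)) ->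
  (forall m, is_derive (T_ 0%N z) 1 (F_ m) (F_ m.+1 (T_ 0%N z))) ->
  is_derive z 1
    (fun w => \sum_(l < i.+1) bell i l (fun m => T_ m w) * F_ l (T_ 0%N w))
    (\sum_(l < i.+2) bell i.+1 l (fun m => T_ m z) * F_ l (T_ 0%N z)).
Proof.
move=> dT dF; set T1 := T_ 1%N z.
pose B a b := bell a b (fun m => T_ m z).
pose dB l := B i.+1 l - (if l is l'.+1 then T1 * B i l' else 0).
have dBP l : is_derive z 1 (fun w => bell i l (fun m => T_ m w)) (dB l).
  case: l => [|l]; first by rewrite /dB subr0; exact: is_derive_bell0.
  exact: is_derive_bellS.
have : is_derive z 1
    (fun w => \sum_(l < i.+1) bell i l (fun m => T_ m w) * F_ l (T_ 0%N w))
    (\sum_(l < i.+1) (dB l * F_ l (T_ 0%N z) + B i l * (F_ l.+1 (T_ 0%N z) * T1))).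
  apply: is_derive_sumf => l; apply: is_deriveMf => //.
  exact: (is_derive1_compN _ (T_ 0%N) (F_ l)).
congr is_derive; rewrite big_split /=.
rewrite [RHS]big_ord_recr /= -/(B _ _).
rewrite /dB; under eq_bigr do rewrite mulrBl.
rewrite sumrB -addrA; congr (_ + _).
rewrite [X in - X]big_ord_recl /= mul0r add0r [X in _ + X]big_ord_recr /=.
have -> : \sum_(l < i) T1 * B i l * F_ (bump 0 l) (T_ 0%N z) =
   \sum_(l < i) B i l * (F_ l.+1 (T_ 0%N z) * T1).
  by apply: eq_bigr => l _; rewrite /bump /= add1n; ring.
rewrite addrA addNr add0r /B !bell_diag exprS -/T1; ring.
Qed.

(** Back-substitution: [m] counts the unknowns found so far from index [n] downwards. Each new one
    is a quotient by a diagonal entry without zeros, hence differentiable. *)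
Lemma derivable_triangular_solve D n (M : nat -> nat -> K -> K) (A : nat -> K -> K) :
  (forall j l z, D z -> derivable (M j l) z 1) ->
  (forall l z, (l <= n)%N -> D z -> derivable (A l) z 1) ->
  (forall j l z, (j < l)%N -> D z -> M j l z = 0) ->
  (forall l z, D z -> M l l z != 0) ->
  exists b : nat -> K -> K, (forall j z, (j <= n)%N -> D z -> derivable (b j) z 1) /\
    forall l z, (l <= n)%N -> D z -> \sum_(j < n.+1) b j z * M j l z = A l z.
Proof.
move=> dM dA M0 Md.
suff H m : (m <= n.+1)%N -> exists b : nat -> K -> K,
   (forall j z, (n.+1 - m <= j <= n)%N -> D z -> derivable (b j) z 1) /\
    forall l z, (n.+1 - m <= l <= n)%N -> D z -> \sum_(j < n.+1) b j z * M j l z = A l z.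
  by have [b [b1 b2]] := H n.+1 (leqnn _); exists b; split => *;
    [apply: b1|apply: b2]; rewrite ?subnn.
elim: m => [_|m IH mn].
  exists (fun _ _ => 0); split => [j|l] z; rewrite subn0 => /andP[/leq_trans H /H];
    by rewrite ltnn.
have [b [b1 b2]] := IH (ltnW mn).
pose l0 := (n - m)%N; have El : (n.+1 - m)%N = l0.+1 by rewrite subSn.
rewrite subSS -/l0; rewrite El in b1 b2.
have l0n : (l0 < n.+1)%N by rewrite ltnS leq_subr.
(* The cut-off drops the values [b j] not yet determined, about whose differentiability nothing is
   known; they meet zero entries of [M]. *)
pose t (j : 'I_n.+1) z := if (l0 < j)%N then b j z * M j l0 z else 0.
pose c z := (A l0 z - \sum_(j < n.+1) t j z) / M l0 l0 z.
exists (fun j => if j == l0 then c else b j); split.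
  move=> j z; have [->|jl] := eqVneq j l0; last first.
    by move=> /andP[lj jn] Dz; apply: b1 => //; rewrite ltn_neqAle eq_sym jl lj.
  move=> _ Dz; apply: derivableM; last first.
    by apply: derivableV => //; [exact: Md|exact: dM].
  apply: derivableB; first exact: dA.
  have dt (j0 : 'I_n.+1) : derivable (t j0) z 1.
    rewrite /t; case: (ltnP l0 j0) => lj; last exact: derivable_cst.
    by apply: derivableM; [apply: b1; rewrite // lj -ltnS ltn_ord|exact: dM].
  by case: (@is_derive_sumf K n.+1 t z (fun i => 'D_1 (t i) z) (fun i => derivableP (dt i))).
have ne0 (j : 'I_n.+1) : j != Ordinal l0n -> j != l0 :> nat.
  by apply: contraNneq => jl; apply/eqP/val_inj.
move=> l z /andP[ll ln] Dz.
rewrite (bigD1 (Ordinal l0n)) //= eqxx.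
move: ll; rewrite leq_eqVlt => /predU1P[<-|ll]; last first.
  rewrite M0 // mulr0 add0r -(b2 l z) ?ll // [RHS](bigD1 (Ordinal l0n)) //=.
  by rewrite [M l0 l z]M0 // mulr0 add0r; apply: eq_bigr => j /ne0/negbTE ->.
rewrite /c divfK ?Md // [X in _ - X](bigD1 (Ordinal l0n)) //= /t ltnn add0r.
apply/eqP; rewrite -addrA -[X in _ == X]addr0 (inj_eq (addrI _)) addrC subr_eq0; apply/eqP.
apply: eq_bigr => j /ne0 jl; rewrite (negbTE jl).
by case: ltngtP jl => // jl _; rewrite M0 // mulr0.
Qed.

End HigherDerivatives.

(** * The transfer matrix *)

Section AnalyticDerivatives.
Context {R : realType}.
Implicit Types (D : set (CC R)) (f g : CC R -> CC R).

Lemma open_norm1 D z : open D -> D z ->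
  exists2 r : R, 0 < r & forall v : R[i], norm1 v < r -> D (z + v).
Proof.
move=> oD Dz; have /nbhs_ballP[d /= d0 H] := open_nbhs_nbhs (conj oD Dz).
have [r r0 rd] : exists2 r : R, 0 < r & r%:C%C = d.
  by case: (d) d0 => a b; rewrite ltcE /= => /andP[/eqP -> a0]; exists a.
exists r => // v vr; apply: H; rewrite /ball /= opprD addNKr normrN -rd.
by rewrite (le_lt_trans (norm_le_norm1 _)) // ltcR.
Qed.

Lemma analytic_is_derive D f z : analytic_on D f -> D z ->
  is_derive (z : R[i]^o) 1 f (derive1 f z).
Proof. by move=> /(_ z) af /af; rewrite derive1E => /derivableP. Qed.

(** The integral formula enters the algebraic part only through this statement and its iteration. *)
Lemma analytic_derive1 D f : open D -> analytic_on D f -> analytic_on D (derive1 f).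
Proof.
move=> oD af z Dz; have [r r0 Hr] := open_norm1 _ _ oD Dz.
have [|L /cdiffP[]//] := @cdiff_derivative R f (derive1 f) z r r0.
by move=> v /Hr Dv; apply/cdiffP; exact: analytic_is_derive af Dv.
Qed.

Lemma analytic_cder D f n : open D -> analytic_on D f -> analytic_on D (cder n f).
Proof.
move=> oD af; elim: n => [|n IH]; first by rewrite /cder derive1n0.
by rewrite /cder derive1nS; exact: analytic_derive1.
Qed.

Lemma is_derive_cder D f n z : open D -> analytic_on D f -> D z ->
  is_derive (z : R[i]^o) 1 (cder n f) (cder n.+1 f z).
Proof.
move=> oD af Dz; rewrite [cder n.+1 f]derive1nS.
exact: analytic_is_derive (analytic_cder _ _ n oD af) Dz.
Qed.

End AnalyticDerivatives.

Section TransferMatrix.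
Context {R : realType}.
Implicit Types (D : set (CC R)) (f T h : CC R -> CC R).

(* [transfer T h j l] is the coefficient of [f^(l) o T] in [((f o T) h)^(j)]. *)
Definition transfer T h (j l : nat) (z : R[i]) : R[i] :=
  \sum_(i < j.+1) 'C(j, i)%:R * bell i l (fun m => cder m T z) * cder (j - i) h z.

Lemma cder_comp_mul D1 D2 f T h n z : open D1 -> open D2 ->
  analytic_on D1 f -> analytic_on D2 T -> analytic_on D2 h ->
  (forall w, D2 w -> D1 (T w)) -> D2 z ->
  cder n (fun w => f (T w) * h w) z =
  \sum_(l < n.+1) transfer T h n l z * cder l f (T z).
Proof.
move=> o1 o2 af aT ah TD Dz.
(* Candidates for the derivatives of [f o T] and of the product; each must differentiate to the
   next. *)
pose u_ (i : nat) (w : R[i]) : R[i] :=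
  \sum_(l < i.+1) bell i l (fun m => cder m T w) * cder l f (T w).
pose g_ (m : nat) (w : R[i]) : R[i] :=
  \sum_(i < m.+1) 'C(m, i)%:R * u_ i w * cder (m - i) h w.
have du i w : D2 w -> is_derive (w : R[i]^o) 1 (u_ i : R[i]^o -> R[i]^o) (u_ i.+1 w).
  move=> Dw; apply: (@is_derive_faadibruno _ (fun m => cder m T) (fun m => cder m f)).
    by move=> m; apply: is_derive_cder o2 aT Dw.
  by move=> m; apply: is_derive_cder o1 af (TD _ Dw).
have -> : cder n (fun w => f (T w) * h w) z = g_ n z.
  apply: (@derive1n_eq (R[i]) D2 _ g_ o2) => // [w Dw|m w Dw].
    rewrite /g_ /u_ !big_ord1 bin0 mul1r subn0 /cder !derive1n0.
    by rewrite bell_diag expr0 mul1r.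
  apply: is_derive_leibniz => i; first exact: du.
  exact: is_derive_cder o2 ah Dw.
rewrite /g_ /transfer; under [RHS]eq_bigr do rewrite mulr_suml.
rewrite exchange_big /=; apply: eq_bigr => i _.
(* The range of [l] is made independent of [i] by adding zero terms, so that the sums can be
   exchanged. *)
have -> : u_ i z = \sum_(l < n.+1) bell i l (fun m => cder m T z) * cder l f (T z).
  rewrite /u_ (big_ord_widen n.+1 (fun l => bell i l (fun m => cder m T z) * cder l f (T z))) //.
  rewrite big_mkcond /=; apply: eq_bigr => l _; case: ltnP => // il.
  by rewrite bell_gt ?mul0r.
rewrite mulr_sumr mulr_suml; apply: eq_bigr => l _; ring.
Qed.

End TransferMatrix.

Local Arguments cder : simpl never.

Section TransferMatrixTheory.
Context {R : realType}.
Implicit Types (D : set (CC R)) (T h : CC R -> CC R).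

Lemma transfer_gt T h j l z : (j < l)%N -> transfer T h j l z = 0.
Proof.
move=> jl; rewrite /transfer big1 // => i _.
by rewrite bell_gt ?mulr0 ?mul0r // (leq_ltn_trans _ jl) // -ltnS.
Qed.

Lemma transfer_diag T h l z : transfer T h l l z = cder 1 T z ^+ l * h z.
Proof.
rewrite /transfer big_ord_recr /= big1 ?add0r => [|i _].
  by rewrite binn mul1r bell_diag subnn /cder derive1n0.
by rewrite bell_gt ?mulr0 ?mul0r.
Qed.

Lemma transfer_col0 T h j z : transfer T h j 0 z = cder j h z.
Proof.
rewrite /transfer big_ord_recl /= big1 ?addr0 => [|i _].
  by rewrite bin0 mul1r bell0 mul1r subn0.
by rewrite bell0 mulr0 mul0r.
Qed.

(** Identifies the bracket of the stated identity as [M_(j,l) / M_(l,l)]; the terms with [i < l]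
    vanish. *)
Lemma transfer_sum_div T h j l z :
  \sum_(l <= i < j.+1) 'C(j, i)%:R * (bell i l (fun m => cder m T z) / cder 1 T z ^+ l) *
    (cder (j - i) h z / h z) = transfer T h j l z / (cder 1 T z ^+ l * h z).
Proof.
rewrite /transfer -(big_mkord xpredT (fun i => 'C(j, i)%:R * bell i l (fun m => cder m T z) *
  cder (j - i) h z)) mulr_suml.
have [lj|jl] := leqP l j.+1; last first.
  rewrite big_geq ?(ltnW jl) // big_nat big1 // => i /andP[_ ij].
  by rewrite bell_gt ?mulr0 ?mul0r // (ltn_trans ij).
rewrite [RHS](@big_cat_nat _ _ _ l) //= [X in _ = X + _]big_nat [X in _ = X + _]big1 ?add0r.
  apply: eq_bigr => i _; rewrite invfM; ring.
by move=> i /andP[_ il]; rewrite bell_gt ?mulr0 ?mul0r.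
Qed.

Lemma derivable_transfer D T h j l z : open D -> analytic_on D T -> analytic_on D h ->
  D z -> derivable (transfer T h j l : R[i]^o -> R[i]^o) (z : R[i]^o) 1.
Proof.
move=> oD aT ah Dz.
have dB i : derivable (fun w : R[i]^o => bell i l (fun m => cder m T w) : R[i]^o) z 1.
  have dT m : is_derive (z : R[i]^o) 1 (cder m T) (cder m.+1 T z).
    exact: is_derive_cder oD aT Dz.
  case: l => [|l']; first by case: (@is_derive_bell0 _ (fun m => cder m T) z i).
  by case: (@is_derive_bellS _ (fun m => cder m T) z dT i l').
have dt (i : 'I_j.+1) : derivable (fun w : R[i]^o => 'C(j, i)%:R *
    bell i l (fun m => cder m T w) * cder (j - i) h w : R[i]^o) z 1.
  apply: derivableM; last exact: analytic_cder oD ah _ Dz.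
  by apply: derivableM; [exact: derivable_cst|exact: dB].
by case: (@is_derive_sumf (R[i]) _ _ _ _ (fun i => derivableP (dt i))).
Qed.

Lemma branch_neq0 D T h k z : branch_pow D T h k -> D z -> h z != 0.
Proof.
move=> [_ H] Dz; apply: contra_eq_neq (H z Dz) => ->.
by rewrite expr0n mul0r eq_sym oner_eq0.
Qed.

(* Differentiating [h^2 (T')^(k-1) = 1]: this is why the equation for [g] has
   no term of order [k - 1]. *)
Lemma transfer_subdiag D T h n z : open D -> analytic_on D T -> branch_pow D T h n.+2 ->
  D z -> cder 1 T z != 0 -> transfer T h n.+2 n.+1 z = 0.
Proof.
move=> oD aT bh Dz T1; have h0 := branch_neq0 _ _ _ _ _ bh Dz; case: bh => ah bh.
have dT := is_derive_cder D T 1 z oD aT Dz.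
have dh := is_derive_cder D h 0 z oD ah Dz.
have dP : is_derive (z : R[i]^o) 1 (fun w : R[i]^o => h w ^+ 2 * cder 1 T w ^+ n.+1 : R[i]^o) 0.
  apply: near_eq_is_derive (is_derive_cst (1 : R[i]^o) z 1).
  by apply: filterS (open_nbhs_nbhs (conj oD Dz)) => w Dw; rewrite /= bh.
have dQ : is_derive (z : R[i]^o) 1 (fun w : R[i]^o => h w ^+ 2 * cder 1 T w ^+ n.+1 : R[i]^o)
    (2 * h z * cder 1 h z * cder 1 T z ^+ n.+1 +
     h z ^+ 2 * (n.+1%:R * cder 1 T z ^+ n * cder 2 T z)).
  exact: (is_deriveMf _ _ _ _ _ (is_deriveXf _ _ _ 2 dh) (is_deriveXf _ _ _ n.+1 dT)).
have E : 2 * h z * cder 1 h z * cder 1 T z ^+ n.+1 +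
     h z ^+ 2 * (n.+1%:R * cder 1 T z ^+ n * cder 2 T z) = 0.
  by have [_ e1] := dP; have [_ e2] := dQ; rewrite -e2; exact: e1.
rewrite /transfer big_ord_recr big_ord_recr /= big1 ?add0r => [|i _]; last first.
  by rewrite bell_gt ?mulr0 ?mul0r.
rewrite subSnn subnn binn mul1r bell_diag bell_subdiag /= binSn.
have -> : 'C(n.+2, 2)%:R = n.+2%:R * n.+1%:R / 2 :> R[i].
  have := bin_ffact n.+2 2; rewrite (_ : 2`! = 2%N) // ffactnS ffactn1 => /(congr1 (fun x => x%:R : R[i])).
  by rewrite !natrM => <-; rewrite mulfK // pnatr_eq0.
have -> : cder 0 h z = h z by rewrite /cder derive1n0.
move: E; set x := n.+1%:R; set y := n.+2%:R; set a := cder 1 T z ^+ n; rewrite exprS -/a.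
move: (cder 1 T z) (cder 2 T z) (cder 1 h z) x y a (h z) h0 => t1 t2 h1 x y a h0 hn E.
(* [h] times the entry is [(n + 2) / 2] times the left side of [E]. *)
by apply: (mulfI hn); rewrite mulr0 -(mulr0 (y / 2)) -E; field.
Qed.

End TransferMatrixTheory.

(** * The new equation and its coefficients *)

Theorem theorem1 (R : realType) (k : nat) (O1 O2 : set (CC R))
  (T h : CC R -> CC R) (a : nat -> CC R -> CC R) (f : 'I_k -> CC R -> CC R) :
  (2 <= k)%N ->
  domain O1 -> domain O2 ->
  conformal_onto O2 O1 T ->
  branch_pow O2 T h k ->
  (forall j, (j <= k - 2)%N -> analytic_on O1 (a j)) ->
  solution_base O1 k a f ->
  exists b : nat -> CC R -> CC R,
    [/\ (forall j, (j <= k - 2)%N -> analytic_on O2 (b j)),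
        solution_base O2 k b (fun i z => f i (T z) * h z),
        (forall l : nat, (1 <= l <= k - 2)%N -> forall z, O2 z ->
           a l (T z) * cder 1 T z ^+ (k - l) =
             \sum_(l <= j < k)
                (if (j < k.-1)%N then b j z else 0) (* convention b_{k-1} = 0 *) *
                (\sum_(l <= i < j.+1)
                   'C(j, i)%:R * (bell i l (fun m => cder m T z) / cder 1 T z ^+ l) *
                   (cder (j - i) h z / h z))
           + \sum_(l <= i < k)
                'C(k, i)%:R * (bell i l (fun m => cder m T z) / cder 1 T z ^+ l) *
                (cder (k - i) h z / h z)
           + bell k l (fun m => cder m T z) / cder 1 T z ^+ l) &
        (forall z, O2 z ->
           a 0%N (T z) * cder 1 T z ^+ k =
             cder k h z / h z
           + \sum_(1 <= j < k.-1) b j z * (cder j h z / h z)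
           + b 0%N z)].
Proof.
case: k f => [|[|n]] // f _ [_ [ o1 _]] [_ [ o2 _]] [aT T1 _ TO] bh aa [af sf If].
have h0 z : O2 z -> h z != 0 by exact: branch_neq0 bh.
have ah : analytic_on O2 h by case: bh.
have TD w : O2 w -> O1 (T w) by move=> Dw; rewrite -TO; exists w.
rewrite !subSS subn0 in aa *.
pose M := transfer T h.
(* With [k = n + 2] the unknowns are [b_0, ..., b_n]; the term [j = k], whose coefficient is 1, is
   moved to the right-hand side. *)
pose A l z : R[i] := h z * cder 1 T z ^+ n.+2 * a l (T z) - M n.+2 l z.
have [| | | |b [ab Eb]] := @derivable_triangular_solve (R[i]) O2 n M A.
- by move=> j l z Dz; exact: derivable_transfer o2 aT ah Dz.
- move=> l z ln Dz; apply: derivableB; last exact: derivable_transfer o2 aT ah Dz.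
  apply: derivableM.
    apply: derivableM; first exact: ah.
    by case: (@is_deriveXf (R[i]) _ _ _ n.+2 (is_derive_cder _ _ 1 _ o2 aT Dz)).
  have dTz := analytic_is_derive _ _ _ aT Dz.
  have daz := analytic_is_derive _ _ _ (aa l ln) (TD z Dz).
  by case: (@is_derive1_compN (R[i]) _ _ _ _ _ dTz daz).
- by move=> j l z jl _; exact: transfer_gt.
- move=> l z Dz; rewrite /M transfer_diag mulf_neq0 ?h0 //.
  by rewrite expf_neq0 // T1.
have {}Eb l z : (l <= n)%N -> O2 z -> \sum_(j < n.+1) b j z * M j l z + M n.+2 l z =
    h z * cder 1 T z ^+ n.+2 * a l (T z).
  by move=> ln Dz; rewrite Eb // subrK.
exists b; split.
- by move=> j jn z; exact: ab.
- split.
  + move=> i z Dz; apply: derivableM; last exact: ah.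
    have dTz := analytic_is_derive _ _ _ aT Dz.
    have dfz := analytic_is_derive _ _ _ (af i) (TD z Dz).
    by case: (@is_derive1_compN (R[i]) _ _ _ _ _ dTz dfz).
  + move=> i z Dz /=.
    have G m := @cder_comp_mul R O1 O2 (f i) T h m z o1 o2 (af i) aT ah TD Dz.
    rewrite G big_ord_recr big_ord_recr /= transfer_diag (transfer_subdiag _ _ _ _ _ o2 aT bh Dz (T1 z Dz)).
    rewrite mul0r addr0.
    (* The old equation removes the top derivative; what remains is a combination of [f_i^(l) o T]
       with [l <= n], whose coefficients vanish by [Eb]. *)
    have -> : cder n.+2 (f i) (T z) = - \sum_(l < n.+1) a l (T z) * cder l (f i) (T z).
      by apply/eqP; rewrite -addr_eq0; apply/eqP; have := sf i (T z) (TD z Dz).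
    have -> : \sum_(j < n.+1) b j z * cder j (fun w => f i (T w) * h w) z =
       \sum_(l < n.+1) (\sum_(j < n.+1) b j z * M j l z) * cder l (f i) (T z).
      under [RHS]eq_bigr do rewrite mulr_suml.
      rewrite [RHS]exchange_big /=; apply: eq_bigr => j _; rewrite G mulr_sumr.
      rewrite (big_ord_widen n.+1 (fun l => b j z * (transfer T h j l z * cder l (f i) (T z)))) //.
      rewrite big_mkcond /=; apply: eq_bigr => l _; case: ltnP => jl; first by rewrite mulrA.
      by rewrite /M transfer_gt // mulr0 mul0r.
    rewrite mulrN mulr_sumr addrAC -big_split /= -sumrB big1 // => l _.
    have ln : (l <= n)%N by rewrite -ltnS.
    rewrite -mulrDl [X in X * _]addrC (Eb l z ln Dz).
    by rewrite [h z * _]mulrC [X in _ - X]mulrA subrr.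
  (* A vanishing combination is divided by [h], and every point of [O1] is some [T z]. *)
  + move=> c Hc; apply: If => w; rewrite -TO => -[z Dz <-].
    have := Hc z Dz; under eq_bigr do rewrite mulrA; rewrite -mulr_suml => /eqP.
    by rewrite mulf_eq0 (negbTE (h0 z Dz)) orbF => /eqP.
- move=> l /andP[l1 ln] z Dz.
  have hz := h0 z Dz; have Tz := T1 z Dz.
  (* The separate Bell term of the statement is the summand [i = k] of [M_(k,l) / M_(l,l)], where
     the quotient of [h] by itself is 1. *)
  have -> : \sum_(l <= i < n.+2) 'C(n.+2, i)%:R * (bell i l (fun m => cder m T z) / cder 1 T z ^+ l) *
       (cder (n.+2 - i) h z / h z) = M n.+2 l z / (cder 1 T z ^+ l * h z) -
      bell n.+2 l (fun m => cder m T z) / cder 1 T z ^+ l.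
    apply/eqP; rewrite -subr_eq opprK /M -transfer_sum_div [X in _ == X]big_nat_recr /=; last first.
      by rewrite (leq_trans ln) // ltnW.
    rewrite binn mul1r subnn /cder derive1n0 divff // mulr1 //.
  rewrite -addrA subrK.
  under eq_bigr do rewrite transfer_sum_div.
  rewrite big_nat_recr /=; last by rewrite (leq_trans ln) // ltnW.
  rewrite ltnn mul0r addr0.
  have -> : \sum_(l <= j < n.+1) (if (j < n.+1)%N then b j z else 0) *
      (transfer T h j l z / (cder 1 T z ^+ l * h z)) =
      (\sum_(j < n.+1) b j z * M j l z) / (cder 1 T z ^+ l * h z).
    rewrite -(big_mkord xpredT (fun j => b j z * M j l z)) mulr_suml.
    rewrite [RHS](@big_cat_nat _ _ _ l) //= ?(leq_trans ln) //.
    rewrite [X in _ = X + _]big_nat [X in _ = X + _]big1 ?add0r.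
      by apply: eq_big_nat => j /andP[_ ->]; rewrite mulrA.
    by move=> j /andP[_ jl]; rewrite /M transfer_gt ?mulr0 ?mul0r.
  rewrite -mulrDl Eb //.
  have -> : cder 1 T z ^+ n.+2 = cder 1 T z ^+ (n.+2 - l) * cder 1 T z ^+ l.
    by rewrite -exprD subnK // (leq_trans ln) // ltnW.
  have Tl : cder 1 T z ^+ l != 0 by rewrite expf_neq0.
  move: (cder 1 T z ^+ l) (cder 1 T z ^+ (n.+2 - l)) Tl hz => x y x0 hz.
  by field; rewrite x0 hz.
- move=> z Dz; have hz := h0 z Dz.
  (* Column 0 of the matrix consists of the derivatives of [h], so row [l = 0] of the system is the
     last identity times [h]. *)
  have := Eb 0%N z (leq0n n) Dz; under eq_bigr do rewrite /M transfer_col0.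
  rewrite /M transfer_col0 -(big_mkord xpredT (fun j => b j z * cder j h z)) big_ltn //=.
  rewrite [cder 0 h]derive1n0 => E.
  apply: (mulfI hz); rewrite mulrCA mulrA mulrAC -mulrA.
  rewrite !mulrDr mulr_sumr.
  have -> : \sum_(1 <= j < n.+1) h z * (b j z * (cder j h z / h z)) =
     \sum_(1 <= j < n.+1) b j z * cder j h z.
    by apply: eq_bigr => j _; field.
  rewrite [X in X = _](_ : _ = h z * cder 1 T z ^+ n.+2 * a 0%N (T z)); last by ring.
  by rewrite -E; field.
Qed.
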